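(* Let $n\ge2$ and $\theta\in(0,\pi)$. There exists a positive constant $\widetilde\Lambda=\widetilde\Lambda(n,\theta)$ with the following property: if $u$ is a smooth function on $\mathbb{R}^n_+$ (smooth up to the boundary) whose graph is a capillary minimal graph with angle $\theta$, and $u$ is bounded either from above or from below by a constant on $\mathbb{R}^n_+$, then $$\sup_{\overline{\mathbb{R}^n_+}}|Du|\le\widetilde\Lambda .$$
   Context: $\mathbb{R}^n_+=\{x\in\mathbb{R}^n: x_1>0\}$, $\partial\mathbb{R}^n_+=\{x_1=0\}$, $Du=(u_1,\dots,u_n)$ is the Euclidean gradient, $u_i=\partial u/\partial x_i$. The graph $\{(x,u(x)):x\in\mathbb{R}^n_+\}$ is a capillary minimal graph with angle $\theta$ if $$\operatorname{div}\left(\frac{Du}{\sqrt{1+|Du|^2}}\right)=0\ \text{ in }\mathbb{R}^n_+,\qquad u_1=-\cos\theta\sqrt{1+|Du|^2}\ \text{ on }\partial\mathbb{R}^n_+ .$$ The constant $\widetilde\Lambda$ does not depend on $u$ nor on the bounding constant. *)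

(* Defs.v *)
From HB Require Import structures.
From mathcomp Require Import all_boot all_order all_algebra.
From mathcomp Require Import all_classical all_reals all_analysis.

Set Implicit Arguments.
Unset Strict Implicit.
Unset Printing Implicit Defensive.

Import Order.TTheory GRing.Theory Num.Theory.
Import numFieldNormedType.Exports.

Local Open Scope classical_set_scope.
Local Open Scope ring_scope.

(* The ambient space is 'rV[R]_n.+1, of dimension n.+1; the coordinate x_1 of
   the text is the entry of index ord0.  The library norm on row vectors is the
   sup norm, so the Euclidean norm is introduced separately (both define the
   same topology). *)

Section HalfSpace.
Context {R : realType} {n : nat}.
Implicit Types (u : 'rV[R]_n.+1 -> R) (x v : 'rV[R]_n.+1) (i : 'I_n.+1).

Definition half_space : set 'rV[R]_n.+1 := [set x | 0 < x ord0 ord0].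

Definition closed_half_space : set 'rV[R]_n.+1 := [set x | 0 <= x ord0 ord0].

Definition half_space_boundary : set 'rV[R]_n.+1 := [set x | x ord0 ord0 = 0].

Definition basis_vector i : 'rV[R]_n.+1 := delta_mx ord0 i.

Definition enorm v : R := Num.sqrt (\sum_i v ord0 i ^+ 2).

(* Same difference quotient as in the library's [derive], but with increments
   that stay in the closed half-space: at boundary points the derivative in the
   normal direction is one-sided, and elsewhere this is the usual partial
   derivative (see [partialE]).  Only the values of u on the closed half-space
   matter. *)
Definition diff_quotient u i x : R -> R :=
  fun h => h^-1 *: ((u \o shift x) (h *: basis_vector i) - u x).

Definition increments i x : set_system R :=
  within [set h | closed_half_space (h *: basis_vector i + x)] 0^'.

Definition partial i u x : R := lim (diff_quotient u i x @ increments i x).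

Definition has_partial i u x : Prop := cvg (diff_quotient u i x @ increments i x).

(* [iter_partial [:: i1; ...; ik] u] is the partial derivative of u of order k
   with respect to x_ik, ..., x_i1, in this order. *)
Definition iter_partial (s : seq 'I_n.+1) u : 'rV[R]_n.+1 -> R :=
  foldr partial u s.

(* Smoothness on the open half-space, up to the boundary. *)
Definition smooth_up_to_boundary u : Prop :=
  forall s : seq 'I_n.+1,
    {within closed_half_space, continuous (iter_partial s u)} /\
    (forall i x, closed_half_space x -> has_partial i (iter_partial s u) x).

Definition grad u x : 'rV[R]_n.+1 := \row_i partial i u x.

Definition divergence (F : 'rV[R]_n.+1 -> 'rV[R]_n.+1) x : R :=
  \sum_i partial i (fun y => F y ord0 i) x.

Definition area_element u x : R := Num.sqrt (1 + enorm (grad u x) ^+ 2).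

Definition capillary_minimal_graph (theta : R) u : Prop :=
  (forall x, half_space x ->
     divergence (fun y => (area_element u y)^-1 *: grad u y) x = 0) /\
  (forall x, half_space_boundary x ->
     partial ord0 u x = - cos theta * area_element u x).

Lemma incrementsE i x : half_space x -> increments i x = 0^'.
Proof.
move=> x0.
have H : \forall h \near (0 : R)^', closed_half_space (h *: basis_vector i + x).
  apply: nbhs_dnbhs; near=> h.
  rewrite /closed_half_space /= !mxE eqxx /=.
  have h_lt : `|h| < x ord0 ord0.
    by near: h; exact: (@nbhs0_lt R R^o _ x0).
  have := ler_norm (- h); rewrite normrN => Nh.
  case: (_ == _); last by rewrite mulr0 add0r ltW.
  by rewrite mulr1 -lerBlDl sub0r (le_trans Nh)// ltW.
apply/seteqP; split=> A.
  by rewrite /increments /within /= => HA; apply: filterS2 HA H => h /[apply].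
by rewrite /increments /within /= => HA; apply: filterS HA.
Unshelve. all: by end_near. Qed.

Lemma partialE i u x : half_space x -> partial i u x = 'D_(basis_vector i) u x.
Proof. by move=> x0; rewrite /partial incrementsE. Qed.

Lemma has_partialE i u x :
  half_space x -> has_partial i u x <-> derivable u x (basis_vector i).
Proof. by move=> x0; rewrite /has_partial incrementsE. Qed.

End HalfSpace.

Arguments half_space : clear implicits.
Arguments closed_half_space : clear implicits.
Arguments half_space_boundary : clear implicits.

(* Main.v *)
(* Write W for the area element of the graph, c for cos theta, and measure
   lengths and Laplacians with the induced metric.  The function v = W + c u_1
   gains the curvature term W |A|^2 in its elliptic inequality, and the capillary
   condition makes its conormal derivative vanish.  Multiply v by a cutoff eta:
   at an interior maximum of eta v the term |A|^2 absorbs the mixed term by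
   completing the square, and there remains
     (v / W) Lap(eta) <= c^2 |grad x_1|^2 |grad eta|^2 / eta,   v / W >= 1 - |c|.
   Take eta to be a polynomial in t = x_1 / m and
     phi = 1 +- (u - C) / (2 m) - t / 16 - (d / m)^2 |x|^2,
   whose gradient stays away from 0 wherever W is large.
   With c = 0 and eta = phi^2 t^2 this bounds W phi^2 t^2.
   In the wedge 4 K t <= phi take eta = phi^4 + phi^3 t + K phi^2 t^2.  For large K
   its Laplacian contains 2 K phi^2 |grad x_1|^2 / m^2, which beats the right-hand
   side because the latter carries the same factor |grad x_1|^2; this is what allows
   every contact angle.  The term phi^3 t makes the conormal derivative of eta
   positive on the boundary, so the maximum is not attained there, and the previous
   bound controls the other face t = phi / (4 K).  For m large the given point lies
   in the wedge and phi >= 1/4 there. *)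

Require Import Defs.
From mathcomp Require Import all_boot all_order all_algebra.
From mathcomp Require Import all_classical all_reals all_analysis.
From mathcomp Require Import ring lra.
Import Order.TTheory GRing.Theory Num.Theory.
Import numFieldNormedType.Exports.
Local Open Scope classical_set_scope.
Local Open Scope ring_scope.

Set Implicit Arguments.
Unset Strict Implicit.
Unset Printing Implicit Defensive.

(** * Directional derivatives *)

(** The bound must not see C, and u may be unbounded on the other side. Hence the scale m is left
    free and chosen last, depending on the point: after multiplication by m^2 the inequality at an
    interior maximum involves only scale-free quantities, so every bound is uniform in m. This needs
    m^2 Lap(phi) to be scale free as well: u and the coordinates are harmonic on a minimal graph, so
    only the quadratic term contributes, by a multiple of d^2. That term makes {phi >= 0} compact,
    and d is small against sin^2 theta so that it disturbs neither the gradient of phi nor the sign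
    at the boundary. No Riemannian structure is built: gradients and Laplacians on the graph are
    sums of directional derivatives over the rows of a square root of the inverse metric. Since
    derivatives across the boundary are one-sided, derivatives are carried as explicit formulas in
    the iterated partials, which are continuous up to the boundary, and the conditions at a maximum
    are tested along lines only. *)

Section DirectionalCalculus.
Context {R : realType} {V : normedModType R}.
Implicit Types (f : V -> R) (x v w : V).

(** Both difference quotients are the same function of the increment. This is the passage from
    directional derivatives to one-variable calculus. *)
Lemma is_derive_lineP f x v (t d : R) :
  is_derive (t *: v + x) v f d <-> is_derive t 1 (fun s : R => f (s *: v + x)) d.
Proof.
have E : (fun h : R => h^-1 *: ((f \o shift (t *: v + x)) (h *: v) - f (t *: v + x)))
  = (fun h : R => h^-1 *: (((fun s : R => f (s *: v + x)) \o shift t) (h *: 1)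
       - f (t *: v + x))).
  apply/funext => h /=; rewrite addrA -scalerDl.
  by rewrite [h *: 1]mulr1.
split=> -[H1 H2]; split.
- by rewrite /derivable -E.
- by rewrite /derive -E.
- by rewrite /derivable E.
- by rewrite /derive E.
Qed.

Lemma is_derive_lineP0 f x v (d : R) :
  is_derive x v f d <-> is_derive (0 : R) 1 (fun s : R => f (s *: v + x)) d.
Proof. by have := is_derive_lineP f x v 0 d; rewrite scale0r add0r. Qed.

Lemma is_derive_scale f x v (d h : R) :
  is_derive x v f d -> is_derive x (h *: v) f (h * d).
Proof.
move=> fd.
have := (is_derive_lineP f x (h *: v) 0 (h * d)).
rewrite scale0r add0r => ->.
rewrite (_ : (fun s : R => _) = (fun s : R => f (s *: v + x)) \o (fun s => s * h));
  last by apply/funext => s /=; rewrite scalerA.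
rewrite mulrC.
apply: is_derive1_comp; first by rewrite mul0r; apply/is_derive_lineP; rewrite scale0r add0r.
have := @is_deriveM R R (@id R) (cst h) 0 1 1 0 (is_derive_id _ _) (is_derive_cst _ _ _).
by rewrite /= scaler0 add0r [h *: 1]mulr1; apply.
Qed.

Lemma mean_value_dir f (df : R -> R) x v :
  (forall t : R, 0 <= t <= 1 -> is_derive (t *: v + x) v f (df t)) ->
  exists2 t : R, 0 < t < 1 & f (v + x) - f x = df t.
Proof.
move=> fd; pose g (s : R) := f (s *: v + x).
have gd (t : R) : 0 <= t <= 1 -> is_derive t 1 g (df t).
  by move=> t01; apply/is_derive_lineP/fd.
have gc : {within `[0, 1], continuous g}.
  apply: derivable_within_continuous => t; rewrite in_itv/= => t01.
  by case: (gd _ t01).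
have [t|t + ] := @MVT _ g df 0 1 ltr01 _ gc.
  by rewrite in_itv/= => /andP[t0 t1]; apply: gd; rewrite !ltW.
rewrite in_itv/= => t01; rewrite subr0 mulr1 /g scale1r scale0r add0r => E.
by exists t.
Qed.

(** The hypotheses are asymmetric on purpose: along [v] only the derivative at [x] is known, so
    directions can be assembled from basis vectors one at a time. *)
Lemma is_derive_dirD f (df : V -> R) x v w (dv : R) :
  is_derive x v f dv ->
  (\forall y \near x, is_derive y w f (df y)) ->
  {for x, continuous df} ->
  is_derive x (v + w) f (dv + df x).
Proof.
move=> fv fw cdf.
suff H : (fun h : R => h^-1 *: ((f \o shift x) (h *: (v + w)) - f x)) @ 0^'
           --> dv + df x.
  by split; [apply/cvg_ex; exists (dv + df x)|exact: cvg_lim H].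
have {fv}fv : (fun h : R => h^-1 *: ((f \o shift x) (h *: v) - f x)) @ 0^' --> dv.
  by case: fv => c <-; exact: c.
(* Move along [v] first, then along [w] from the displaced point; the mean value theorem handles the
   second leg, where continuity of [df] is used. *)
rewrite (_ : (fun h : R => _) =
  (fun h : R => h^-1 *: ((f \o shift x) (h *: v) - f x)
     + h^-1 *: (f (h *: w + (h *: v + x)) - f (h *: v + x)))); last first.
  apply/funext => h /=; rewrite -scalerDr; congr (_ *: _).
  by rewrite [RHS]addrC addrA subrK scalerDr addrA (addrC (h *: w)).
apply: cvgD fv _.
apply/cvgrPdist_lt => e e0.
have : \forall y \near x, is_derive y w f (df y) /\ `|df x - df y| < e.
  near=> y; split; first by near: y.
  by near: y; move/cvgrPdist_lt: cdf; apply.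
move=> /nbhs_ballP[r /= r0 Hr].
have : \forall h \near (0 : R)^', `|h| * (`|v| + `|w|) < r.
  apply: nbhs_dnbhs.
  have : (fun h : R => `|h| * (`|v| + `|w|)) @ 0 --> (`|(0 : R)| * (`|v| + `|w|)).
    by apply: cvgM; [exact: norm_continuous|exact: cvg_cst].
  by rewrite normr0 mul0r => /cvgr_lt; apply.
move=> Hh0; near=> h.
have h0 : h != 0 by near: h; exact: nbhs_dnbhs_neq.
have Hh : `|h| * (`|v| + `|w|) < r by near: h.
have ball_t (t : R) : 0 <= t <= 1 -> ball x r (t *: (h *: w) + (h *: v + x)).
  move=> /andP[t0 t1]; rewrite -ball_normE /= addrA opprD addrCA subrr addr0 normrN.
  apply: le_lt_trans Hh; rewrite (le_trans (ler_normD _ _))// !normrZ mulrDr addrC.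
  by rewrite lerD2l ler_piMl ?mulr_ge0// ger0_norm.
have [t t01 ->] := @mean_value_dir f (fun t => h * df (t *: (h *: w) + (h *: v + x)))
   (h *: v + x) (h *: w)
   (fun t t01 => is_derive_scale _ (Hr _ (ball_t t t01)).1).
rewrite [_^-1 *: _]mulrA mulVf// mul1r.
apply: (Hr _ (ball_t t _)).2.
by case/andP: t01 => ? ?; rewrite !ltW.
Unshelve. all: by end_near. Qed.

(** The mean value theorem twice: along [v] for the increment of f by h w, then along [w] for
    [fv]. *)
Lemma second_difference f (fv fvw : V -> R) x v w (r : R) (h : R) :
  0 < h -> h * (`|v| + `|w|) < r ->
  (forall y, ball x r y -> is_derive y v f (fv y)) ->
  (forall y, ball x r y -> is_derive y w fv (fvw y)) ->
  exists2 y, ball x r y &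
    f (h *: v + (h *: w + x)) - f (h *: w + x) - (f (h *: v + x) - f x)
      = h * (h * fvw y).
Proof.
move=> h0 hr Hv Hw.
have ball_st (s t : R) : 0 <= s <= 1 -> 0 <= t <= 1 ->
    ball x r (s *: (h *: v) + (t *: (h *: w) + x)).
  move=> /andP[s0 s1] /andP[t0 t1].
  rewrite -ball_normE /= addrA opprD addrCA subrr addr0 normrN.
  apply: le_lt_trans hr; rewrite (le_trans (ler_normD _ _))// !normrZ mulrDr.
  rewrite (ger0_norm s0) (ger0_norm t0) (gtr0_norm h0).
  by rewrite lerD// ler_piMl// mulr_ge0// ltW.
have H1 (s : R) : 0 <= s <= 1 -> is_derive (s *: (h *: v) + x) (h *: v)
    (fun y => f (h *: w + y) - f y)
    (h * (fv (h *: w + (s *: (h *: v) + x)) - fv (s *: (h *: v) + x))).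
  move=> s01; rewrite mulrBr.
  apply: is_deriveB.
    have := Hv _ (ball_st s 1 s01 _); rewrite scale1r ler01 lexx => /(_ isT).
    rewrite addrCA => /(is_derive_scale h)/is_derive_lineP0 H.
    by apply/is_derive_lineP0; under eq_fun do rewrite addrCA.
  have := Hv _ (ball_st s 0 s01 _); rewrite scale0r add0r ler01 lexx => /(_ isT).
  exact: is_derive_scale.
have [s s01 E1] := mean_value_dir H1.
have {}s01 : 0 <= s <= 1 by case/andP: s01 => ? ?; rewrite !ltW.
have H2 (t : R) : 0 <= t <= 1 -> is_derive (t *: (h *: w) + (s *: (h *: v) + x)) (h *: w)
    fv (h * fvw (t *: (h *: w) + (s *: (h *: v) + x))).
  move=> t01; apply: is_derive_scale; apply: Hw.
  by rewrite addrCA; exact: ball_st.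
have [t t01 E2] := mean_value_dir H2.
have {}t01 : 0 <= t <= 1 by case/andP: t01 => ? ?; rewrite !ltW.
exists (t *: (h *: w) + (s *: (h *: v) + x)); first by rewrite addrCA; exact: ball_st.
by rewrite -E2 -E1 (addrCA (h *: v)); ring.
Qed.

(** The second difference is symmetric in [v] and [w], so it represents both mixed derivatives, at
    two possibly different points of a small ball. By continuity these values are too close to the
    ones at [x] for the latter to differ. *)
Lemma derive_comm f (fv fw fvw fwv : V -> R) x v w :
  (\forall y \near x, is_derive y v f (fv y) /\ is_derive y w f (fw y)) ->
  (\forall y \near x, is_derive y w fv (fvw y) /\ is_derive y v fw (fwv y)) ->
  {for x, continuous fvw} -> {for x, continuous fwv} ->
  fvw x = fwv x.
Proof.
move=> H1 H2 c1 c2; apply/eqP; rewrite -subr_eq0 -normr_le0 leNgt; apply/negP => e0.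
set e := `|_| in e0.
have : \forall y \near x, [/\ is_derive y v f (fv y), is_derive y w f (fw y),
    is_derive y w fv (fvw y), is_derive y v fw (fwv y) &
    `|fvw x - fvw y| < e / 2 /\ `|fwv x - fwv y| < e / 2].
  near=> y; split.
  - by apply: (near H1 y _).1.
  - by apply: (near H1 y _).2.
  - by apply: (near H2 y _).1.
  - by apply: (near H2 y _).2.
  - by split; near: y; [move/cvgrPdist_lt: c1|move/cvgrPdist_lt: c2]; apply;
      rewrite divr_gt0.
move=> /nbhs_ballP[r /= r0 Hr].
(* The summand 1 keeps the denominator positive when both directions vanish. *)
pose h := r / (2 * (`|v| + `|w| + 1)).
have N0 : 0 < `|v| + `|w| + 1 by rewrite ltr_wpDl// addr_ge0.
have h0 : 0 < h by rewrite divr_gt0// mulr_gt0.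
have hr : h * (`|v| + `|w|) < r.
  rewrite /h mulrAC ltr_pdivrMr ?mulr_gt0// ltr_pM2l//.
  by rewrite mulrDr mulr1 (mulr_natl _ 2) mulr2n; lra.
have [y By Ey] : exists2 y, ball x r y & _ := @second_difference f fv fvw x v w r h h0 hr
  (fun y By => let: And5 a _ _ _ _ := Hr y By in a)
  (fun y By => let: And5 _ _ a _ _ := Hr y By in a).
rewrite addrC in hr; rewrite addrC in hr.
have hr' : h * (`|w| + `|v|) < r by rewrite (addrC `|w|).
have [z Bz Ez] : exists2 y, ball x r y & _ := @second_difference f fw fwv x w v r h h0 hr'
  (fun y By => let: And5 _ a _ _ _ := Hr y By in a)
  (fun y By => let: And5 _ _ _ a _ := Hr y By in a).
have : h * (h * fvw y) = h * (h * fwv z).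
  by rewrite -Ey -Ez (addrCA (h *: w)); ring.
move=> /(mulfI (lt0r_neq0 h0)) /(mulfI (lt0r_neq0 h0)) Eyz.
have [_ _ _ _ [dy _]] := Hr _ By; have [_ _ _ _ [_ dz]] := Hr _ Bz.
have : e < e.
  rewrite {1}/e (_ : fvw x - fwv x = (fvw x - fvw y) - (fwv x - fwv z)); last by rewrite Eyz; ring.
  by rewrite (le_lt_trans (ler_normB _ _))// [ltRHS](splitr e) ltrD.
by rewrite ltxx.
Unshelve. all: by end_near. Qed.

End DirectionalCalculus.

(** * Smooth functions on the closed half-space *)

Section HalfSpaceTopology.
Context {R : realType} {n : nat}.
Implicit Types (x : 'rV[R]_n.+1) (f : 'rV[R]_n.+1 -> R).

Lemma half_space_closed x : half_space R n x -> closed_half_space R n x.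
Proof. exact: ltW. Qed.

Lemma open_half_space : open (half_space R n).
Proof.
have := @open_comp _ _ (fun x : 'rV[R]_n.+1 => x ord0 ord0) [set t : R | 0 < t].
by apply; [move=> x _; exact: coord_continuous|exact: open_gt].
Qed.

Lemma closed_closed_half_space : closed (closed_half_space R n).
Proof.
have := @closed_comp _ _ (fun x : 'rV[R]_n.+1 => x ord0 ord0) [set t : R | 0 <= t].
by apply; [move=> x _; exact: coord_continuous|exact: closed_ge].
Qed.

Lemma near_half_space x : half_space R n x -> \forall y \near x, half_space R n y.
Proof. by move=> xU; apply: open_nbhs_nbhs; split=> //; exact: open_half_space. Qed.

Definition cont_to_boundary f := forall x, closed_half_space R n x ->
  f y @[y --> within (closed_half_space R n) (nbhs x)] --> f x.

Lemma closed_half_space_normal (t : R) x : 0 <= t -> closed_half_space R n x ->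
  closed_half_space R n (t *: basis_vector ord0 + x).
Proof. by move=> t0 xC; rewrite /closed_half_space /= !mxE eqxx mulr1 addr_ge0. Qed.

(** The filter is arbitrary so as to serve both limits from the right at 0 and continuity on a
    closed segment that starts at the boundary. *)
Lemma cont_to_boundary_normal f x (F : set_system R) {FF : Filter F} (t0 : R) :
  cont_to_boundary f -> closed_half_space R n x -> 0 <= t0 -> F --> t0 ->
  (\forall t \near F, 0 <= t) ->
  f (t *: basis_vector ord0 + x) @[t --> F] --> f (t0 *: basis_vector ord0 + x).
Proof.
move=> cf xC t00 Ft0 Fge0 B /(cf _ (closed_half_space_normal t00 xC)).
rewrite /= !nbhs_simpl /within /= => HB.
have c : t *: basis_vector ord0 + x @[t --> F] --> t0 *: basis_vector ord0 + x.
  by apply: cvgD; [apply: cvgZl Ft0|exact: cvg_cst].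
near=> t.
have t_ge0 : 0 <= t by near: t.
suff : closed_half_space R n (t *: basis_vector ord0 + x) ->
    B (f (t *: basis_vector ord0 + x)).
  by apply; exact: closed_half_space_normal.
by near: t; apply: c HB.
Unshelve. all: by end_near. Qed.

End HalfSpaceTopology.

Section SmoothHalfSpace.
Context {R : realType} {n : nat} (u : 'rV[R]_n.+1 -> R).
Context (smooth_u : smooth_up_to_boundary u).
Implicit Types (x b : 'rV[R]_n.+1) (s : seq 'I_n.+1) (i j k : 'I_n.+1).
Local Notation D := iter_partial.

Lemma smooth_cvg s : cont_to_boundary (D s u).
Proof. by move=> x xU; have [/subspace_continuousP + _] := smooth_u s; exact. Qed.

Lemma smooth_continuous s x : half_space R n x -> {for x, continuous (D s u)}.
Proof.
move=> xU A /(@smooth_cvg s x (half_space_closed xU)).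
rewrite /= !nbhs_simpl /within /= => H.
near=> y; apply: (near H y) => //.
by apply: half_space_closed; near: y; exact: near_half_space.
Unshelve. all: by end_near. Qed.

(** A tangential increment never leaves the closed half-space, so for i <> 0 the restricted limit is
    an ordinary two-sided one even at boundary points. *)
Lemma smooth_is_derive_basis s i x :
  closed_half_space R n x -> half_space R n x \/ i != ord0 ->
  is_derive x (basis_vector i) (D s u) (D (i :: s) u x).
Proof.
move=> xC xi.
have E : increments i x = 0^'.
  case: xi => [/incrementsE->//|i0].
  have H h : closed_half_space R n (h *: basis_vector i + x).
    rewrite /closed_half_space /= !mxE eqxx/= (eq_sym _ i) (negbTE i0) mulr0 add0r.
    exact: xC.
  apply/seteqP; split => A.
    by rewrite /increments /within /= => HA; apply: filterS HA => h; apply.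
  by rewrite /increments /within /= => HA; apply: filterS HA.
have [_ /(_ i x xC)] := smooth_u s.
rewrite /has_partial E => H.
by split; [exact: H|rewrite /= /partial E].
Qed.


(** A formula instead of a limit, so that it is meaningful and continuous up to the boundary for
    every direction, also for those that leave the half-space. *)
Definition dir_deriv (b : 'rV[R]_n.+1) s x : R := \sum_i b ord0 i * D (i :: s) u x.

Lemma dir_deriv_basis i s x : dir_deriv (basis_vector i) s x = D (i :: s) u x.
Proof.
rewrite /dir_deriv (bigD1 i)//= mxE !eqxx mul1r big1 ?addr0// => j ji.
by rewrite mxE eqxx (negbTE ji) mul0r.
Qed.

Lemma smooth_is_derive s b x : half_space R n x -> is_derive x b (D s u) (dir_deriv b s x).
Proof.
move=> xU; rewrite {1}[b]row_sum_delta /dir_deriv.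
elim: (index_enum _) => [|i r IH]; first by rewrite !big_nil; exact: is_derive0.
rewrite !big_cons [X in is_derive _ X _ _]addrC [X in is_derive _ _ _ X]addrC.
refine (is_derive_dirD (df := fun y => b ord0 i * D (i :: s) u y) IH _ _).
  near=> y; apply: is_derive_scale; apply: smooth_is_derive_basis; last first.
    by left; near: y; exact: near_half_space.
  by apply: half_space_closed; near: y; exact: near_half_space.
by apply: (@cvgM _ _ (nbhs x) _ (cst (b ord0 i)) (D (i :: s) u));
  [exact: cvg_cst|exact: smooth_continuous].
Unshelve. all: by end_near. Qed.

Lemma smooth_partialC_interior s i j x : half_space R n x ->
  D [:: i, j & s] u x = D [:: j, i & s] u x.
Proof.
move=> xU; have H y k r : half_space R n y -> is_derive y (basis_vector k) (D r u) (D (k :: r) u y).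
  by move=> yU; apply: smooth_is_derive_basis; [exact: half_space_closed|left].
apply: (@derive_comm _ _ (D s u) (D (j :: s) u) (D (i :: s) u) _ _ x
  (basis_vector j) (basis_vector i)); try exact: smooth_continuous.
  by near=> y; split; apply: H; near: y; exact: near_half_space.
by near=> y; split; apply: H; near: y; exact: near_half_space.
Unshelve. all: by end_near. Qed.

Lemma smooth_cvg_normal s x : closed_half_space R n x ->
  (fun t : R => D s u (t *: basis_vector ord0 + x)) @ 0^'+ --> D s u x.
Proof.
move=> xC; rewrite -[X in _ --> D s u X]add0r -(scale0r (basis_vector ord0)).
apply: cont_to_boundary_normal => //; first exact: smooth_cvg.
  exact: cvg_at_right_filter.
by near=> t; apply: ltW; near: t; exact: nbhs_right_gt.
Unshelve. all: by end_near. Qed.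

(** Boundary points inherit the symmetry as limits along the inner normal. *)
Lemma smooth_partialC s i j x : closed_half_space R n x ->
  D [:: i, j & s] u x = D [:: j, i & s] u x.
Proof.
move=> xC; have c1 := @smooth_cvg_normal [:: i, j & s] x xC.
have c2 := @smooth_cvg_normal [:: j, i & s] x xC.
have E : {near (0 : R)^'+, (fun t : R => D [:: i, j & s] u (t *: basis_vector ord0 + x))
    =1 (fun t : R => D [:: j, i & s] u (t *: basis_vector ord0 + x))}.
  near=> t; apply: smooth_partialC_interior; rewrite /half_space /= !mxE eqxx mulr1.
  by rewrite ltr_pwDl.
have c3 : (fun t : R => D [:: j, i & s] u (t *: basis_vector ord0 + x)) @ 0^'+
    --> D [:: i, j & s] u x by exact: cvg_trans (near_eq_cvg E) c1.
exact: (norm_cvg_unique c3 c2).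
Unshelve. all: by end_near. Qed.

(** Brings the derivative in x_k outermost, as it appears when the equation is differentiated in
    x_k. The inner swap must hold on a neighbourhood, because it is differentiated in x_i
    afterwards. *)
Lemma smooth_partial_rot i j k x : half_space R n x ->
  D [:: i; j; k] u x = D [:: k; i; j] u x.
Proof.
move=> xU; apply: etrans (@smooth_partialC_interior [:: j] i k x xU).
have near_eq : \near x, D [:: j; k] u x = D [:: k; j] u x.
  near=> y; apply: (@smooth_partialC_interior [::] j k).
  by near: y; exact: near_half_space.
have E r : D (i :: r) u x = 'D_(basis_vector i) (D r u) x by exact: (@partialE R n i (D r u) x xU).
by rewrite !(E [:: _; _]); exact: near_eq_derive near_eq.
Unshelve. all: by end_near. Qed.

End SmoothHalfSpace.

(** * Differentiation rules along a fixed direction *)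

Section PointwiseRules.
Context {R : realType} {V : normedModType R}.
Implicit Types (f g : V -> R) (x v : V) (df dg : R).

Lemma is_derive_addf f g x v df dg : is_derive x v f df -> is_derive x v g dg ->
  is_derive x v (fun y => f y + g y) (df + dg).
Proof. exact: is_deriveD. Qed.

Lemma is_derive_mulf f g x v df dg : is_derive x v f df -> is_derive x v g dg ->
  is_derive x v (fun y => f y * g y) (df * g x + f x * dg).
Proof.
move=> Hf Hg; apply: is_derive_eq (is_deriveM Hf Hg) _.
by rewrite addrC [df * _]mulrC.
Qed.

Lemma is_derive_scalef f x v df (c : R) : is_derive x v f df ->
  is_derive x v (fun y => c * f y) (c * df).
Proof.
move=> Hf; apply: is_derive_eq (is_derive_mulf (is_derive_cst c x v) Hf) _.
by rewrite mul0r add0r.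
Qed.

Lemma is_derive_sumf (I : Type) (r : seq I) (h : I -> V -> R) (dh : I -> R) x v :
  (forall i, is_derive x v (h i) (dh i)) ->
  is_derive x v (fun y => \sum_(i <- r) h i y) (\sum_(i <- r) dh i).
Proof.
move=> H; elim: r => [|i r IH].
  by under eq_fun do rewrite big_nil; rewrite big_nil; exact: is_derive_cst.
under eq_fun do rewrite big_cons; rewrite big_cons.
exact: is_derive_addf.
Qed.

Lemma is_derive_chain f (k : R -> R) x v df dk : is_derive x v f df ->
  is_derive (f x) 1 k dk -> is_derive x v (fun y => k (f y)) (df * dk).
Proof.
move=> /is_derive_lineP0 Hf Hk; apply/is_derive_lineP0.
rewrite mulrC; apply: (@is_derive1_comp _ k (fun s : R => f (s *: v + x))) Hf.
by rewrite scale0r add0r.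
Qed.

Lemma is_derive_sqrtf f x v df : is_derive x v f df -> 0 < f x ->
  is_derive x v (fun y => Num.sqrt (f y)) (df / (2 * Num.sqrt (f x))).
Proof. by move=> Hf f0; apply: is_derive_chain Hf _; exact: is_derive1_sqrt. Qed.

Lemma is_derive_invf f x v df : is_derive x v f df -> f x != 0 ->
  is_derive x v (fun y => (f y)^-1) (- df / f x ^+ 2).
Proof.
move=> [Hf <-] f0; split; first exact: derivableV.
by rewrite deriveV// [LHS]mulrC mulrN mulNr.
Qed.

Lemma is_derive_coord (n : nat) (x b : 'rV[R]_n) (i : 'I_n) :
  is_derive x b (fun y : 'rV[R]_n => y ord0 i) (b ord0 i).
Proof.
apply/is_derive_lineP0.
rewrite (_ : (fun s : R => _) = (fun s : R => b ord0 i * s + x ord0 i)); last first.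
  by apply/funext => s; rewrite !mxE mulrC.
rewrite -[X in is_derive _ _ _ X]addr0 -[X in is_derive _ _ _ (X + _)]mulr1.
exact: is_deriveD.
Qed.

End PointwiseRules.

(** * First and second derivatives of the area element *)

Section AreaElement.
Context {R : realType} {n : nat} (u : 'rV[R]_n.+1 -> R).
Context (smooth_u : smooth_up_to_boundary u).
Implicit Types (x b : 'rV[R]_n.+1) (s : seq 'I_n.+1) (i j k : 'I_n.+1).
Local Notation D s := (iter_partial s u).
Local Notation W := (area_element u).
Local Notation dir := (dir_deriv u).

(* At boundary points only directions tangent to the boundary are available. *)
Definition derivable_along b x := forall s, is_derive x b (D s) (dir b s x).

Definition dir_deriv2 b s x := \sum_i b ord0 i * dir b (i :: s) x.

Definition darea b x := (\sum_k D [:: k] x * dir b [:: k] x) / W x.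

Definition d2area b x :=
  (\sum_k (dir b [:: k] x ^+ 2 + D [:: k] x * dir_deriv2 b [:: k] x)) / W x
  - (\sum_k D [:: k] x * dir b [:: k] x) ^+ 2 / W x ^+ 3.

Lemma area_elementE x : W x = Num.sqrt (1 + \sum_k D [:: k] x ^+ 2).
Proof.
rewrite /area_element /enorm sqr_sqrtr ?sumr_ge0// => [|i _]; last exact: sqr_ge0.
by congr (Num.sqrt (1 + _)); apply: eq_bigr => i _; rewrite mxE.
Qed.

Lemma area_element_sqr x : W x ^+ 2 = 1 + \sum_k D [:: k] x ^+ 2.
Proof.
by rewrite area_elementE sqr_sqrtr// addr_ge0// sumr_ge0// => i _; exact: sqr_ge0.
Qed.

Lemma area_element_ge1 x : 1 <= W x.
Proof.
rewrite area_elementE -[leLHS]sqrtr1 ler_wsqrtr// lerDl sumr_ge0// => i _.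
exact: sqr_ge0.
Qed.

Lemma area_element_gt0 x : 0 < W x.
Proof. exact: lt_le_trans (area_element_ge1 x). Qed.

(** The hypothesis is [derivable_along] and not interiority, so that the capillary condition can be
    differentiated tangentially at boundary points. *)
Lemma is_derive_area b x : derivable_along b x -> is_derive x b W (darea b x).
Proof.
move=> H; rewrite (_ : W = fun y => Num.sqrt (1 + \sum_k D [:: k] y * D [:: k] y)); last first.
  by apply/funext => y; rewrite area_elementE.
have p0 : 0 < 1 + \sum_k D [:: k] x * D [:: k] x.
  by have := area_element_sqr x; rewrite -[X in _ = X]/(1 + \sum_k D [:: k] x ^+ 2) => <-;
    rewrite exprn_gt0// area_element_gt0.
have Hs : is_derive x b (fun y => 1 + \sum_k D [:: k] y * D [:: k] y)
    (0 + \sum_k (dir b [:: k] x * D [:: k] x + D [:: k] x * dir b [:: k] x)).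
  apply: (is_derive_addf (is_derive_cst (1 : R) x b)).
  by apply: is_derive_sumf => k; apply: is_derive_mulf; exact: H.
apply: is_derive_eq (is_derive_sqrtf Hs p0) _.
rewrite -[Num.sqrt _]/(Num.sqrt (1 + \sum_k D [:: k] x ^+ 2)) -area_elementE.
rewrite /darea add0r (eq_bigr (fun k => 2 * (D [:: k] x * dir b [:: k] x))); last first.
  by move=> k _; ring.
by rewrite -mulr_sumr invfM mulrACA divff ?mul1r// pnatr_eq0.
Qed.

Lemma smooth_derivable_along b x : half_space R n x -> derivable_along b x.
Proof. by move=> xU s; exact: smooth_is_derive. Qed.

Lemma smooth_derivable_tangent i x : closed_half_space R n x -> i != ord0 ->
  derivable_along (basis_vector i) x.
Proof.
move=> xC i0 s; rewrite dir_deriv_basis.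
by apply: smooth_is_derive_basis => //; right.
Qed.

Lemma is_derive_dir b s x : half_space R n x ->
  is_derive x b (dir b s) (dir_deriv2 b s x).
Proof.
move=> xU; apply: is_derive_sumf => i.
by apply: is_derive_scalef; exact: smooth_derivable_along.
Qed.

Lemma is_derive_darea b x : half_space R n x -> is_derive x b (darea b) (d2area b x).
Proof.
move=> xU; have xA := smooth_derivable_along b xU.
have W0 : W x != 0 by rewrite gt_eqF// area_element_gt0.
have Hn : is_derive x b (fun y => \sum_k D [:: k] y * dir b [:: k] y)
   (\sum_k (dir b [:: k] x ^+ 2 + D [:: k] x * dir_deriv2 b [:: k] x)).
  apply: is_derive_sumf => k; rewrite expr2; apply: is_derive_mulf; first exact: xA.
  exact: is_derive_dir.
apply: is_derive_eq (is_derive_mulf Hn (is_derive_invf (is_derive_area xA) W0)) _.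
by rewrite /d2area /darea; field.
Qed.

End AreaElement.

(** * The metric of a graph *)

Section DotProduct.
Context {R : realType} {N : nat}.
Implicit Types (x y z p : 'rV[R]_N) (T M : 'M[R]_N) (a : R).

Definition dotv x y : R := \sum_i x ord0 i * y ord0 i.

Lemma dotvC x y : dotv x y = dotv y x.
Proof. by apply: eq_bigr => i _; rewrite mulrC. Qed.

Lemma dotvDl x y z : dotv (x + y) z = dotv x z + dotv y z.
Proof. by rewrite -big_split; apply: eq_bigr => i _; rewrite mxE mulrDl. Qed.

Lemma dotvZl a x z : dotv (a *: x) z = a * dotv x z.
Proof. by rewrite mulr_sumr; apply: eq_bigr => i _; rewrite mxE mulrA. Qed.

Lemma dotvDr x y z : dotv z (x + y) = dotv z x + dotv z y.
Proof. by rewrite dotvC dotvDl !(dotvC z). Qed.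

Lemma dotvZr a x z : dotv z (a *: x) = a * dotv z x.
Proof. by rewrite dotvC dotvZl (dotvC z). Qed.

Lemma dotv_delta x i : dotv x (delta_mx ord0 i) = x ord0 i.
Proof.
rewrite /dotv (bigD1 i)//= mxE !eqxx mulr1 big1 ?addr0// => j ji.
by rewrite mxE eqxx (negbTE ji) mulr0.
Qed.

Lemma dotvE x y : x *m y^T = (dotv x y)%:M.
Proof.
by apply/matrixP => i j; rewrite !ord1 !mxE mulr1n; apply: eq_bigr => k _; rewrite mxE.
Qed.

Lemma dotv_mul x y T : dotv (x *m T) y = dotv x (y *m T^T).
Proof.
have : (dotv (x *m T) y)%:M = (dotv x (y *m T^T))%:M :> 'M[R]_1.
  by rewrite -!dotvE trmx_mul trmxK mulmxA.
by move=> /matrixP/(_ ord0 ord0); rewrite !mxE !mulr1n.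
Qed.

Lemma dotvv_ge0 x : 0 <= dotv x x.
Proof. by apply: sumr_ge0 => i _; rewrite -expr2 sqr_ge0. Qed.

Definition quadf T x : R := dotv (x *m T) x.

End DotProduct.

Section GraphFrame.
Context {R : realType} {N : nat} (p : 'rV[R]_N) (W : R).
Context (W_gt0 : 0 < W) (W_sqr : W ^+ 2 = 1 + dotv p p).
Implicit Types (x y : 'rV[R]_N) (T M : 'M[R]_N) (i j k l : 'I_N).

(* Rows of the positive square root of the inverse metric 1 - p^T p / W^2. *)
Definition graph_frame l : 'rV[R]_N :=
  delta_mx ord0 l + (- (p ord0 l / (W * (W + 1)))) *: p.

(** The inverse of the induced metric, as a form on covectors: applied to differentials it gives
    scalar products of gradients on the graph. *)
Definition graph_metric x y : R := dotv x y - dotv x p * dotv y p / W ^+ 2.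

Lemma dotv_frame x l :
  dotv x (graph_frame l) = x ord0 l - (W * (W + 1))^-1 * dotv x p * p ord0 l.
Proof. by rewrite dotvDr dotv_delta dotvZr; ring. Qed.

(** With b = 1 / (W (W + 1)) and |p|^2 = W^2 - 1, the coefficient of (x.p)(y.p) is -2 b + b^2 (W^2 -
    1) = -1 / W^2. *)
Lemma sum_frame x y :
  \sum_l dotv x (graph_frame l) * dotv y (graph_frame l) = graph_metric x y.
Proof.
have W1 : W + 1 != 0 by rewrite gt_eqF// addr_gt0.
have W0 : W != 0 by rewrite gt_eqF.
have E := W_sqr; set b := (W * (W + 1))^-1.
rewrite (eq_bigr (fun l => x ord0 l * y ord0 l - (b * dotv y p) * (x ord0 l * p ord0 l)
  - (b * dotv x p) * (y ord0 l * p ord0 l)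
  + (b ^+ 2 * dotv x p * dotv y p) * (p ord0 l * p ord0 l))); last first.
  by move=> l _; rewrite !dotv_frame -/b; ring.
rewrite !big_split/= !sumrN -!mulr_sumr -![\sum__ _ * _]/(dotv _ _).
have {}E : dotv p p = W ^+ 2 - 1 by rewrite E; ring.
by rewrite E /graph_metric /b; field; rewrite W0.
Qed.

(** The trace of T in the inverse metric. For the Hessian of a function on a minimal graph this is
    its Laplacian. *)
Lemma sum_quadf_frame T :
  \sum_l quadf T (graph_frame l) = \tr T - quadf T p / W ^+ 2.
Proof.
have W1 : W + 1 != 0 by rewrite gt_eqF// addr_gt0.
have W0 : W != 0 by rewrite gt_eqF.
set b := (W * (W + 1))^-1.
have E l : quadf T (graph_frame l) = T l l - b * ((p *m T) ord0 l * p ord0 l)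
  - b * (p ord0 l * (p *m T^T) ord0 l) + (b ^+ 2 * quadf T p) * (p ord0 l * p ord0 l).
  rewrite /quadf /graph_frame mulmxDl -scalemxAl -rowE !(dotvDl, dotvDr, dotvZl, dotvZr).
  rewrite !dotv_delta mxE rowE [dotv (_ *m _) p]dotv_mul (dotvC _ (p *m _)) dotv_delta.
  by rewrite /b; ring.
under eq_bigr do rewrite E.
rewrite !big_split/= !sumrN -!mulr_sumr -![\sum__ _ * _]/(dotv _ _).
rewrite -[dotv p (p *m T^T)]dotv_mul -/(quadf T p).
have -> : dotv p p = W ^+ 2 - 1 by rewrite W_sqr; ring.
by rewrite /b /mxtrace; field; rewrite W0.
Qed.

Lemma graph_metricvv_ge0 x : 0 <= graph_metric x x.
Proof. by rewrite -sum_frame sumr_ge0// => l _; rewrite -expr2 sqr_ge0. Qed.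

End GraphFrame.

Section InteriorAlgebra.
Context {R : realType} {N : nat}.

(* Here p, M, T stand for the first, second and third derivatives of u, and xi
   and eta2 for those of the cutoff eta, at an interior maximum of
   eta (W + c u_e).  The Gauss curvature term sum_{lk} (b_l M b_k)^2 absorbs the
   mixed term by completing the square. *)
Lemma cutoff_hessian_le (p e xi : 'rV[R]_N) (M : 'M[R]_N) (T : 'I_N -> 'M[R]_N)
    (W c v eta : R) (eta2 : 'rV[R]_N -> R) :
  0 < W -> W ^+ 2 = 1 + dotv p p -> M^T = M -> 0 < eta ->
  v = W + c * dotv p e ->
  \tr M * W ^+ 2 = quadf M p ->
  (forall k, \tr (T k) * W ^+ 2 - quadf (T k) p + 2 * \tr M * (p *m M) ord0 k
     - 2 * (p *m M *m M) ord0 k = 0) ->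
  v *: xi + eta *: ((W^-1 *: p + c *: e) *m M) = 0 ->
  (forall b, v * eta2 b + 2 * (dotv xi b * dotv ((W^-1 *: p + c *: e) *m M) b)
     + eta * ((dotv (b *m M) (b *m M) + \sum_k p ord0 k * quadf (T k) b) / W
              - dotv (p *m M) b ^+ 2 / W ^+ 3
              + c * \sum_k e ord0 k * quadf (T k) b) <= 0) ->
  v * eta * \sum_l eta2 (graph_frame p W l) <=
    c ^+ 2 * W * graph_metric p W xi xi * graph_metric p W e e.
Proof.
move=> W0 W2 Msym eta0 vE trM third first second.
have Wn0 : W != 0 by rewrite gt_eqF.
have en0 : eta != 0 by rewrite gt_eqF.
set q := W^-1 *: p + c *: e in first second.
pose b := graph_frame p W.
have sumf := sum_frame W0 W2; have sumq := sum_quadf_frame W0 W2.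
pose X l := dotv xi (b l); pose r l := dotv (e *m M) (b l).
pose P l := dotv (p *m M) (b l); pose a l := dotv (q *m M) (b l).
(* The second fundamental form is M / W, so this is W^2 |A|^2. *)
pose Z := \sum_l \sum_k dotv (b l *m M) (b k) ^+ 2.
have aE l : a l = P l / W + c * r l.
  by rewrite /a /P /r /q mulmxDl -!scalemxAl dotvDl !dotvZl mulrC.
have aX l : a l = - (v / eta) * X l.
  have : dotv (v *: xi + eta *: (q *m M)) (b l) = 0.
    by rewrite first /dotv big1// => i _; rewrite mxE mul0r.
  rewrite dotvDl !dotvZl -/(X l) -/(a l) => E.
  apply: (mulfI en0); rewrite -[LHS](addKr (v * X l)) E; field.
  exact: en0.
have PE l : P l = W * (- (v / eta) * X l - c * r l) by rewrite -aX aE; field.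
pose SX := \sum_l X l * X l; pose SY := \sum_l X l * r l.
pose S := graph_metric p W e e.
have SXE : graph_metric p W xi xi = SX by rewrite -sumf.
have sum_a_P : \sum_l a l * P l = W * ((v / eta) ^+ 2 * SX + c * (v / eta) * SY).
  rewrite mulrDr !mulr_sumr -big_split/=; apply: eq_bigr => l _.
  by rewrite aX PE; ring.
(* The differentiated equation trades the traces of the third derivatives for products of second
   derivatives. *)
have sum_third : \sum_l \sum_k q ord0 k * quadf (T k) (b l) = 2 / W ^+ 2 * \sum_l a l * P l.
  rewrite exchange_big/= sumf /graph_metric.
  rewrite (eq_bigr (fun k => 2 / W ^+ 2 * (q ord0 k * (p *m M *m M) ord0 k)
     - (2 / W ^+ 2 * \tr M) * (q ord0 k * (p *m M) ord0 k))); last first.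
    move=> k _; rewrite -mulr_sumr sumq.
    have -> : quadf (T k) p = \tr (T k) * W ^+ 2 + 2 * \tr M * (p *m M) ord0 k
      - 2 * (p *m M *m M) ord0 k by apply/eqP; rewrite eq_sym -subr_eq0 -(third k); apply/eqP; ring.
    by field.
  rewrite big_split/= sumrN -!mulr_sumr -![\sum__ _ * _]/(dotv _ _).
  have -> : \tr M = quadf M p / W ^+ 2 by rewrite -trM; field.
  have -> : dotv q (p *m M *m M) = dotv (q *m M) (p *m M) by rewrite dotv_mul Msym.
  have -> : dotv q (p *m M) = dotv (q *m M) p by rewrite dotv_mul Msym.
  by rewrite -[dotv (p *m M) p]/(quadf M p); field.
have ZE l : \sum_k dotv (b l *m M) (b k) ^+ 2
    = dotv (b l *m M) (b l *m M) - P l ^+ 2 / W ^+ 2.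
  under eq_bigr do rewrite expr2.
  have -> : P l = dotv (b l *m M) p by rewrite dotv_mul Msym dotvC.
  by rewrite sumf.
have sum_second : v * (\sum_l eta2 (b l)) + 2 * (\sum_l X l * a l)
   + eta * (Z / W + 2 / W ^+ 2 * \sum_l a l * P l) <= 0.
  rewrite -sum_third.
  have -> : v * (\sum_l eta2 (b l)) + 2 * (\sum_l X l * a l)
     + eta * (Z / W + \sum_l \sum_k q ord0 k * quadf (T k) (b l))
    = \sum_l (v * eta2 (b l) + 2 * (X l * a l)
     + eta * ((\sum_k dotv (b l *m M) (b k) ^+ 2) / W
        + \sum_k q ord0 k * quadf (T k) (b l))).
    by rewrite !big_split/= -!mulr_sumr big_split/= mulr_suml.
  apply: sumr_le0 => l _; apply: le_trans (second (b l)); rewrite -/(X l) -/(a l) -/(P l).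
  rewrite lerD2l ler_pM2l// ZE le_eqVlt; apply/orP; left; apply/eqP.
  have -> : \sum_k q ord0 k * quadf (T k) (b l) =
     W^-1 * (\sum_k p ord0 k * quadf (T k) (b l)) + c * \sum_k e ord0 k * quadf (T k) (b l).
    rewrite !mulr_sumr -big_split/=; apply: eq_bigr => k _.
    by rewrite /q !mxE; ring.
  by field.
(* Symmetry of M turns the contraction into [r l] and [P l]; inserting [PE] produces the factor 1 +
   c (p.e) / W = v / W. *)
have NE l : \sum_k dotv (b l *m M) (b k) * dotv e (b k)
    = v / W * r l + dotv p e * v / (W * eta) * X l.
  have sw x : dotv (b l *m M) x = dotv (x *m M) (b l) by rewrite dotv_mul Msym dotvC.
  rewrite sumf /graph_metric (dotvC e p) !sw -/(r l) -/(P l) PE.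
  by rewrite vE; field; rewrite en0 Wn0.
have square (t : R) : 0 <= Z + 2 * t * (v / W * SY + dotv p e * v / (W * eta) * SX)
    + t ^+ 2 * SX * S.
  have -> : Z + 2 * t * (v / W * SY + dotv p e * v / (W * eta) * SX) + t ^+ 2 * SX * S
    = \sum_l \sum_k (dotv (b l *m M) (b k) + t * X l * dotv e (b k)) ^+ 2.
    rewrite (eq_bigr (fun l => \sum_k dotv (b l *m M) (b k) ^+ 2
      + (2 * t * (v / W)) * (X l * r l)
      + (2 * t * (dotv p e * v / (W * eta)) + t ^+ 2 * S) * (X l * X l))); last first.
      move=> l _; rewrite (eq_bigr (fun k => dotv (b l *m M) (b k) ^+ 2
        + (2 * t * X l) * (dotv (b l *m M) (b k) * dotv e (b k))
        + (t ^+ 2 * (X l * X l)) * (dotv e (b k) * dotv e (b k)))); last first.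
        by move=> k _; ring.
      by rewrite !big_split/= -!mulr_sumr NE !sumf -/S; ring.
    by rewrite !big_split/= -!mulr_sumr -/SX -/SY -/Z; ring.
  by apply: sumr_ge0 => l _; apply: sumr_ge0 => k _; exact: sqr_ge0.
rewrite SXE -/S.
have XaE : \sum_l X l * a l = - (v / eta) * SX.
  by rewrite mulr_sumr; apply: eq_bigr => l _; rewrite aX; ring.
move: sum_second; rewrite XaE sum_a_P => sum_second.
(* This t cancels the [SY] terms and, because v - W = c (p.e), the terms linear in [SX] as well.
   Only t^2 [SX] [S] survives, which is the right-hand side. *)
have := square (c * W / eta).
have E2W : 0 < eta ^+ 2 / W by rewrite divr_gt0// exprn_gt0.
rewrite -(pmulr_rge0 _ E2W) => sq.
have : eta * (v * (\sum_l eta2 (b l)) + 2 * (- (v / eta) * SX) +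
      eta * (Z / W + 2 / W ^+ 2 * (W * ((v / eta) ^+ 2 * SX + c * (v / eta) * SY)))) <= 0.
  by rewrite pmulr_rle0.
move=> s2; rewrite -subr_ge0; apply: le_trans (_ : 0 <= _ - _) _.
  by rewrite subr_ge0; exact: le_trans s2 sq.
rewrite le_eqVlt; apply/orP; left; apply/eqP; rewrite [in RHS]mulrC.
by rewrite vE; field; rewrite Wn0 en0.
Qed.

End InteriorAlgebra.

(** * The minimal surface equation at an interior maximum *)

Section LocalMaximum.
Context {R : realType} {V : normedModType R}.
Implicit Types (f : V -> R) (x v : V).

Lemma near_line (P : V -> Prop) x v : (\forall y \near x, P y) ->
  exists2 r : R, 0 < r & forall t : R, `|t| < r -> P (t *: v + x).
Proof.
move=> /nbhs_ballP[d /= d0 H]; exists (d / (`|v| + 1)).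
  by rewrite divr_gt0// ltr_wpDl.
move=> t td; apply: H; rewrite -ball_normE /= opprD addrCA subrr addr0 normrN normrZ.
move: td; rewrite ltr_pdivlMr ?ltr_wpDl//; apply: le_lt_trans.
by rewrite ler_wpM2l// lerDl.
Qed.

Lemma derive_local_max f x v (df : R) : is_derive x v f df ->
  (\forall y \near x, derivable f y v) ->
  (\forall y \near x, f y <= f x) -> df = 0.
Proof.
move=> fd H1 H2.
have [r r0 Hr] := near_line v (filterI H1 H2).
pose g (s : R) := f (s *: v + x).
have : is_derive (0 : R) 1 g 0.
  apply: (@derive1_at_max R g (- r) r 0).
  - by rewrite ge0_cp// ltW.
  - move=> t; rewrite in_itv/= -ltr_norml => /Hr[+ _].
    by move=> /derivableP/is_derive_lineP[].
  - by rewrite in_itv/= oppr_lt0 r0.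
  - by move=> t; rewrite in_itv/= -ltr_norml /g scale0r add0r => /Hr[].
move=> [_ <-]; move/is_derive_lineP0: fd => [_ <-] //.
Unshelve. all: by end_near. Qed.

(** If [d2f] were positive, then [df], which vanishes at [x], would be positive on a short forward
    segment, and f would increase there. *)
Lemma derive2_local_max f (df : V -> R) x v (d2f : R) :
  (\forall y \near x, is_derive y v f (df y)) ->
  is_derive x v df d2f ->
  (\forall y \near x, f y <= f x) -> d2f <= 0.
Proof.
move=> fd dfd fmax; rewrite leNgt; apply/negP => d2f0.
have df0 : df x = 0.
  apply: (@derive_local_max f x v); [exact: nbhs_singleton fd| |exact: fmax].
  by near=> y; case: (near fd y _).
have [r r0 Hr] := near_line v (filterI fd fmax).
have [s s0 Hs] : exists2 s : R, 0 < s & forall t : R, 0 < t < s -> 0 < df (t *: v + x).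
  have : (fun h : R => h^-1 *: ((df \o shift x) (h *: v) - df x)) @ 0^' --> d2f.
    by case: dfd => c <-; exact: c.
  move=> /cvgr_gt/(_ 0 d2f0).
  move=> [s /= s0 Hs]; exists s => // t /andP[t0 ts].
  have := Hs t; rewrite /= sub0r normrN (gtr0_norm t0) => /(_ ts (lt0r_neq0 t0)).
  by rewrite df0 subr0 [_ *: _]mulrC pmulr_lgt0 ?invr_gt0.
pose h := Num.min r s / 2.
have h0 : 0 < h by rewrite divr_gt0// lt_min r0.
have hlt : h < Num.min r s by rewrite /h ltr_pdivrMr// ltr_pMr ?ltr1n// lt_min r0.
have [hr hs] : h < r /\ h < s by move: hlt; rewrite lt_min => /andP[].
have th (t : R) : 0 <= t <= 1 -> `|t * h| < r.
  move=> /andP[t0 t1]; rewrite ger0_norm; last by rewrite mulr_ge0// ltW.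
  by apply: le_lt_trans hr; rewrite ler_piMl// ltW.
have fd1 (t : R) : 0 <= t <= 1 ->
    is_derive (t *: (h *: v) + x) (h *: v) f (h * df ((t * h) *: v + x)).
  by move=> t01; apply: is_derive_scale; rewrite scalerA; case: (Hr _ (th _ t01)).
have [t /andP[t0 t1] E] := mean_value_dir fd1.
have : 0 < f (h *: v + x) - f x.
  rewrite E mulr_gt0// Hs// mulr_gt0//=; apply: lt_trans hs.
  by rewrite gtr_pMl.
rewrite subr_gt0 ltNge; have := (Hr h _).2; rewrite gtr0_norm// => /(_ hr) ->.
by [].
Unshelve. all: by end_near. Qed.

End LocalMaximum.

(** Pure algebra: the x_k-derivative of the equation, in the index form left by the product rule, is
    rewritten with traces and matrix products. Here [q], [h], [t] stand for the gradient, the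
    Hessian and the x_k-derivative of the Hessian. *)
Lemma differentiated_minimal_eq (R : realType) (N : nat) (q : 'I_N -> R)
    (h t : 'I_N -> 'I_N -> R) (w : R) (k : 'I_N) :
  let p := \row_i q i in let H := \matrix_(i, j) h i j in
  let T := \matrix_(i, j) t i j in
  (forall i j, h i j = h j i) -> w = 1 + \sum_l q l * q l ->
  (\sum_i t i i) * (1 + \sum_l q l * q l)
   + (\sum_i h i i) * (0 + \sum_l (h l k * q l + q l * h l k))
   - \sum_i \sum_l ((h i k * q l + q i * h l k) * h l i + q i * q l * t i l) = 0 ->
  \tr T * w - quadf T p + 2 * \tr H * (p *m H) ord0 k - 2 * (p *m H *m H) ord0 k = 0.
Proof.
move=> p H T sw wE E; rewrite -[RHS]E {E} add0r -wE.
have E1 : \tr T = \sum_i t i i by apply: eq_bigr => i _; rewrite mxE.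
have E2 : (p *m H) ord0 k = \sum_l q l * h l k.
  by rewrite mxE; apply: eq_bigr => l _; rewrite !mxE.
have E3 : \tr H = \sum_i h i i by apply: eq_bigr => i _; rewrite mxE.
have E4 : (p *m H *m H) ord0 k = \sum_i \sum_l q i * h l k * h l i.
  rewrite mxE exchange_big/=; apply: eq_bigr => l _.
  by rewrite mxE mulr_suml; apply: eq_bigr => i _; rewrite !mxE (sw l i); ring.
have E5 : quadf T p = \sum_i \sum_l q i * q l * t i l.
  rewrite exchange_big/=; apply: eq_bigr => l _; rewrite !mxE mulr_suml.
  by apply: eq_bigr => i _; rewrite !mxE; ring.
have E6 : \sum_i \sum_l ((h i k * q l + q i * h l k) * h l i + q i * q l * t i l)
   = (p *m H *m H) ord0 k * 2 + quadf T p.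
  have E4' : (p *m H *m H) ord0 k = \sum_i \sum_l q l * h i k * h l i.
    by rewrite E4 exchange_big; apply: eq_bigr => i _; apply: eq_bigr => l _; rewrite (sw l i).
  rewrite mulr_natr mulr2n {1}E4' E4 E5 -!big_split/=.
  apply: eq_bigr => i _; rewrite -!big_split/=; apply: eq_bigr => l _.
  by ring.
have E7 : \sum_l (h l k * q l + q l * h l k) = 2 * \sum_l q l * h l k.
  by rewrite mulr_sumr; apply: eq_bigr => l _; ring.
by rewrite E6 E7 E1 E3 E2; ring.
Qed.

Section InteriorMaximum.
Context {R : realType} {n : nat} (u : 'rV[R]_n.+1 -> R).
Context (smooth_u : smooth_up_to_boundary u).
Implicit Types (x b : 'rV[R]_n.+1) (i j k : 'I_n.+1).
Local Notation D s := (iter_partial s u).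
Local Notation W := (area_element u).
Local Notation dir := (dir_deriv u).
Local Notation e0 := (basis_vector ord0).

Definition hess x : 'M[R]_n.+1 := \matrix_(k, j) D [:: j; k] x.

Lemma hessE x k j : hess x k j = D [:: j; k] x.
Proof. by rewrite mxE. Qed.

Definition third_deriv x k : 'M[R]_n.+1 := \matrix_(i, j) D [:: i; j; k] x.

Lemma third_derivE x k i j : third_deriv x k i j = D [:: i; j; k] x.
Proof. by rewrite mxE. Qed.

Lemma gradE x k : grad u x ord0 k = D [:: k] x.
Proof. by rewrite mxE. Qed.

Lemma trmx_hess x : closed_half_space R n x -> (hess x)^T = hess x.
Proof. by move=> xC; apply/matrixP => i j; rewrite !mxE; exact: (@smooth_partialC _ _ _ smooth_u [::]). Qed.

Lemma dir_derivE b x : dir b [::] x = dotv (grad u x) b.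
Proof. by apply: eq_bigr => i _; rewrite gradE mulrC. Qed.

Lemma dir_deriv_hess b x k : closed_half_space R n x ->
  dir b [:: k] x = (b *m hess x) ord0 k.
Proof. by move=> xC; rewrite -(trmx_hess xC) mxE; apply: eq_bigr => i _; rewrite !mxE. Qed.

Lemma dir_deriv2_hess b x : dir_deriv2 u b [::] x = quadf (hess x)^T b.
Proof.
apply: eq_bigr => i _; rewrite mulrC mxE; congr (_ * _).
by apply: eq_bigr => j _; rewrite !mxE.
Qed.

Lemma dir_deriv2_third b x k : dir_deriv2 u b [:: k] x = quadf (third_deriv x k) b.
Proof.
apply: eq_bigr => i _; rewrite mulrC mxE; congr (_ * _).
by apply: eq_bigr => j _; rewrite third_derivE.
Qed.

Lemma area_element_dotv x : W x ^+ 2 = 1 + dotv (grad u x) (grad u x).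
Proof.
rewrite area_element_sqr; congr (1 + _).
by apply: eq_bigr => k _; rewrite gradE expr2.
Qed.

Lemma area_element_sqrM x : W x ^+ 2 = 1 + \sum_k D [:: k] x * D [:: k] x.
Proof. by rewrite area_element_sqr; congr (1 + _); apply: eq_bigr => k _; rewrite expr2. Qed.

Context (minimal_u : forall x, half_space R n x ->
  divergence (fun y => (W y)^-1 *: grad u y) x = 0).

(** The nondivergence form, obtained on multiplying by W^3. *)
Lemma minimal_eq x : half_space R n x ->
  (\sum_i D [:: i; i] x) * (1 + \sum_k D [:: k] x * D [:: k] x)
   - \sum_i \sum_k D [:: i] x * D [:: k] x * D [:: i; k] x = 0.
Proof.
move=> xU; have := minimal_u xU; rewrite /divergence.
have W0 : W x != 0 by rewrite gt_eqF// area_element_gt0.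
have term i : partial i (fun y => ((W y)^-1 *: grad u y) ord0 i) x
  = D [:: i; i] x / W x - D [:: i] x * (\sum_k D [:: k] x * D [:: i; k] x) / W x ^+ 3.
  rewrite partialE//.
  have -> : (fun y => ((W y)^-1 *: grad u y) ord0 i) = (fun y => (W y)^-1 * D [:: i] y).
    by apply/funext => y; rewrite mxE gradE.
  have xA := smooth_derivable_along smooth_u (basis_vector i) xU.
  have [_ ->] := is_derive_mulf (is_derive_invf (is_derive_area xA) W0) (xA [:: i]).
  rewrite dir_deriv_basis /darea.
  rewrite (eq_bigr (fun k => D [:: k] x * D [:: i; k] x)); last first.
    by move=> k _; rewrite dir_deriv_basis.
  by field.
rewrite (eq_bigr _ (fun i _ => term i)) => E.
have : W x ^+ 3 * 0 = 0 by rewrite mulr0.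
rewrite -[X in _ * X = _]E => {}E; rewrite -[RHS]E.
rewrite big_split/= sumrN -mulr_suml mulrBr.
rewrite -area_element_sqrM.
congr (_ - _); first by field.
rewrite -mulr_suml mulrC divfK ?expf_neq0//; apply: eq_bigr => i _.
by rewrite mulr_sumr; apply: eq_bigr => k _; rewrite mulrA.
Qed.

(** After division by W^2: u is harmonic on its graph. *)
Lemma minimal_hess x : half_space R n x ->
  \tr (hess x) * W x ^+ 2 = quadf (hess x) (grad u x).
Proof.
move=> xU; rewrite area_element_sqrM; have /eqP := minimal_eq xU; rewrite subr_eq0 => /eqP.
have -> : \tr (hess x) = \sum_i D [:: i; i] x by apply: eq_bigr => i _; rewrite mxE.
move=> ->; apply: eq_bigr => i _; rewrite mxE mulr_suml; apply: eq_bigr => k _.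
by rewrite !gradE hessE; ring.
Qed.

Lemma minimal_third x k : half_space R n x ->
  \tr (third_deriv x k) * W x ^+ 2 - quadf (third_deriv x k) (grad u x)
  + 2 * \tr (hess x) * (grad u x *m hess x) ord0 k
  - 2 * (grad u x *m hess x *m hess x) ord0 k = 0.
Proof.
move=> xU; have xC := half_space_closed xU; have xA := smooth_derivable_along smooth_u (basis_vector k) xU.
pose F y := (\sum_i D [:: i; i] y) * (1 + \sum_k D [:: k] y * D [:: k] y)
   - \sum_i \sum_k D [:: i] y * D [:: k] y * D [:: i; k] y.
have HF0 : is_derive x (basis_vector k) F 0.
  apply: (@near_eq_is_derive _ _ _ (cst 0)) (is_derive_cst _ _ _).
  by near=> y; rewrite /F minimal_eq//; near: y; exact: near_half_space.
have d s : is_derive x (basis_vector k) (D s) (D (k :: s) x).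
  by have := xA s; rewrite dir_deriv_basis.
have HF : is_derive x (basis_vector k) F
  ((\sum_i D [:: k; i; i] x) * (1 + \sum_l D [:: l] x * D [:: l] x)
   + (\sum_i D [:: i; i] x)
       * (0 + \sum_l (D [:: k; l] x * D [:: l] x + D [:: l] x * D [:: k; l] x))
   - \sum_i \sum_l ((D [:: k; i] x * D [:: l] x + D [:: i] x * D [:: k; l] x) * D [:: i; l] x
       + D [:: i] x * D [:: l] x * D [:: k; i; l] x)).
  apply: is_deriveB.
    apply: is_derive_mulf; first by apply: is_derive_sumf => i; exact: (d [:: i; i]).
    apply: (is_derive_addf (is_derive_cst (1 : R) x _)); apply: is_derive_sumf => l.
    exact: (is_derive_mulf (d [:: l]) (d [:: l])).
  apply: is_derive_sumf => i; apply: is_derive_sumf => l.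
  exact: (is_derive_mulf (is_derive_mulf (d [:: i]) (d [:: l])) (d [:: i; l])).
have {HF0 HF} E : _ = 0 := etrans (esym (@derive_val _ _ _ _ _ _ _ HF)) (@derive_val _ _ _ _ _ _ _ HF0).
have sw i j : D [:: i; j] x = D [:: j; i] x by exact: (@smooth_partialC _ _ _ smooth_u [::]).
have tE : third_deriv x k = \matrix_(i, j) D [:: k; i; j] x.
  apply/matrixP => i j; rewrite [RHS]mxE [LHS]third_derivE.
  exact: (smooth_partial_rot smooth_u i j k xU).
have K := @differentiated_minimal_eq R n.+1 (fun i => D [:: i] x)
  (fun i j => D [:: j; i] x) (fun i j => D [:: k; i; j] x) (W x ^+ 2) k
  (fun i j => sw j i) (area_element_sqrM x) E.
rewrite tE; exact: K.
Unshelve. all: by end_near. Qed.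


Lemma darea_hess b x : closed_half_space R n x ->
  darea u b x = dotv (grad u x *m hess x) b / W x.
Proof.
move=> xC; rewrite dotv_mul (trmx_hess xC) /darea; congr (_ / _).
by apply: eq_bigr => k _; rewrite gradE (dir_deriv_hess _ _ xC).
Qed.

Lemma dir_deriv0_hess b x : closed_half_space R n x ->
  dir b [:: ord0] x = dotv (e0 *m hess x) b.
Proof. by move=> xC; rewrite (dir_deriv_hess _ _ xC) dotv_mul (trmx_hess xC) dotvC dotv_delta. Qed.

Lemma d2area_hess b x : closed_half_space R n x ->
  d2area u b x = (dotv (b *m hess x) (b *m hess x)
     + \sum_k grad u x ord0 k * quadf (third_deriv x k) b) / W x
     - dotv (grad u x *m hess x) b ^+ 2 / W x ^+ 3.
Proof.
move=> xC; have E := darea_hess b xC; rewrite /darea in E.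
have W0 : W x != 0 by rewrite gt_eqF// area_element_gt0.
have {}E : \sum_k D [:: k] x * dir b [:: k] x = dotv (grad u x *m hess x) b.
  by apply: (mulIf (invr_neq0 W0)).
rewrite /d2area E big_split/=; congr ((_ + _) / _ - _).
  by apply: eq_bigr => k _; rewrite (dir_deriv_hess _ _ xC) expr2.
by apply: eq_bigr => k _; rewrite gradE dir_deriv2_third.
Qed.

Definition capillary_fun (c : R) y := W y + c * D [:: ord0] y.

Definition dcapillary_fun (c : R) b y := darea u b y + c * dir b [:: ord0] y.

Lemma is_derive_capillary_fun c b x : derivable_along u b x ->
  is_derive x b (capillary_fun c) (dcapillary_fun c b x).
Proof.
move=> xA; apply: is_derive_addf; first exact: is_derive_area.
by apply: is_derive_scalef; exact: xA.
Qed.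

Lemma dcapillary_fun_hess c b x : closed_half_space R n x ->
  dcapillary_fun c b x = dotv (((W x)^-1 *: grad u x + c *: e0) *m hess x) b.
Proof.
move=> xC; rewrite /dcapillary_fun (darea_hess _ xC) (dir_deriv0_hess _ xC).
by rewrite mulmxDl -!scalemxAl dotvDl !dotvZl mulrC.
Qed.

(** First and second order conditions for eta v along every line feed [cutoff_hessian_le]. The sum
    of [eta2] over the frame is the Laplacian of eta on the graph, the coordinates being harmonic
    there. *)
Lemma interior_max_cutoff (c : R) x (eta : 'rV[R]_n.+1 -> R)
    (eta1 : 'rV[R]_n.+1 -> 'rV[R]_n.+1 -> R) (eta2 : 'rV[R]_n.+1 -> R) xi :
  half_space R n x ->
  (forall b, \forall y \near x, is_derive y b eta (eta1 b y)) ->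
  (forall b, is_derive x b (eta1 b) (eta2 b)) ->
  (forall b, eta1 b x = dotv xi b) -> 0 < eta x ->
  (\forall y \near x, eta y * capillary_fun c y <= eta x * capillary_fun c x) ->
  capillary_fun c x * eta x * \sum_l eta2 (graph_frame (grad u x) (W x) l)
   <= c ^+ 2 * W x * graph_metric (grad u x) (W x) xi xi
      * graph_metric (grad u x) (W x) e0 e0.
Proof.
move=> xU d1 d2 xiE eta0 Pmax; have xC := half_space_closed xU.
pose P1 b y := eta1 b y * capillary_fun c y + eta y * dcapillary_fun c b y.
have dP b : \forall y \near x, is_derive y b (fun y => eta y * capillary_fun c y) (P1 b y).
  near=> y; apply: is_derive_mulf; first by near: y; exact: d1.
  apply: is_derive_capillary_fun; apply: smooth_derivable_along => //.
  by near: y; exact: near_half_space.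
have first b : P1 b x = 0.
  apply: (@derive_local_max _ _ (fun y => eta y * capillary_fun c y) x b) => //.
    exact: nbhs_singleton (dP b).
  by near=> y; case: (near (dP b) y _).
have second b d : is_derive x b (P1 b) d -> d <= 0.
  by move=> H; exact: derive2_local_max (dP b) H Pmax.
apply: (@cutoff_hessian_le R n.+1 _ _ _ (hess x) (third_deriv x) _ _ _ _ eta2) => //.
- exact: area_element_gt0.
- exact: area_element_dotv.
- exact: trmx_hess.
- by rewrite dotv_delta gradE.
- exact: minimal_hess.
- by move=> k; exact: minimal_third.
- apply/rowP => i; have := first (basis_vector i).
  rewrite /P1 xiE (dcapillary_fun_hess _ _ xC) !dotv_delta => H.
  rewrite [RHS]mxE -[RHS]H [LHS]mxE; congr (_ + _); last by rewrite mxE.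
  by rewrite mxE mulrC.
move=> b; rewrite -xiE -(dcapillary_fun_hess _ _ xC).
have [xA dA] := (smooth_derivable_along smooth_u b xU, is_derive_darea smooth_u b xU).
have := second b (eta2 b * capillary_fun c x + eta1 b x * dcapillary_fun c b x
  + (eta1 b x * dcapillary_fun c b x
     + eta x * (d2area u b x + c * dir_deriv2 u b [:: ord0] x))).
rewrite (d2area_hess _ xC) dir_deriv2_third.
have -> : \sum_k e0 ord0 k * quadf (third_deriv x k) b = quadf (third_deriv x ord0) b.
  rewrite (bigD1 ord0)//= mxE !eqxx mul1r big1 ?addr0// => k k0.
  by rewrite mxE eqxx (negbTE k0) mul0r.
move=> H; apply: le_trans (H _).
  by rewrite le_eqVlt; apply/orP; left; apply/eqP; ring.
rewrite -(d2area_hess _ xC) -dir_deriv2_third.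
apply: is_derive_addf; apply: is_derive_mulf => //.
- exact: is_derive_capillary_fun.
- exact: nbhs_singleton (d1 b).
- apply: is_derive_addf => //; apply: is_derive_scalef; exact: is_derive_dir.
Unshelve. all: by end_near. Qed.

End InteriorMaximum.

(** * Cutoff functions *)

Lemma dotv_cauchy_schwarz (R : realType) (N : nat) (x y : 'rV[R]_N) :
  dotv x y ^+ 2 <= dotv x x * dotv y y.
Proof.
have [yy0|yy0] := eqVneq (dotv y y) 0.
  have y0 i : y ord0 i = 0.
    apply/eqP; rewrite -sqrf_eq0 eq_le sqr_ge0 andbT -[leRHS]yy0 /dotv (bigD1 i)//= expr2 lerDl.
    by apply: sumr_ge0 => j _; rewrite -expr2 sqr_ge0.
  have -> : dotv x y = 0 by rewrite /dotv big1// => i _; rewrite y0 mulr0.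
  by rewrite yy0 mulr0 expr0n.
have {}yy0 : 0 < dotv y y by rewrite lt_neqAle eq_sym yy0 dotvv_ge0.
have := dotvv_ge0 (dotv y y *: x + (- dotv x y) *: y).
rewrite !(dotvDl, dotvDr, dotvZl, dotvZr) (dotvC y x).
set a := dotv x x; set b := dotv x y; set e := dotv y y in yy0 *.
move=> h; have {h} : 0 <= e * (a * e - b ^+ 2).
  by apply: le_trans h _; rewrite le_eqVlt; apply/orP; left; apply/eqP; ring.
by rewrite pmulr_rge0// subr_ge0.
Qed.

Section GraphMetric.
Context {R : realType} {N : nat} (p : 'rV[R]_N) (W : R).
Context (W_gt0 : 0 < W) (W_sqr : W ^+ 2 = 1 + dotv p p).
Implicit Types (x y z : 'rV[R]_N) (a : R).
Local Notation gm := (graph_metric p W).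

Lemma graph_metricC x y : gm x y = gm y x.
Proof. by rewrite /graph_metric (dotvC x y) [dotv x p * _]mulrC. Qed.

Lemma graph_metricDl x y z : gm (x + y) z = gm x z + gm y z.
Proof. by rewrite /graph_metric !dotvDl; ring. Qed.

Lemma graph_metricZl a x z : gm (a *: x) z = a * gm x z.
Proof. by rewrite /graph_metric !dotvZl; ring. Qed.

Lemma graph_metricDr x y z : gm z (x + y) = gm z x + gm z y.
Proof. by rewrite graph_metricC graph_metricDl !(graph_metricC z). Qed.

Lemma graph_metricZr a x z : gm z (a *: x) = a * gm z x.
Proof. by rewrite graph_metricC graph_metricZl (graph_metricC z). Qed.

(** [p] is an eigenvector of the inverse metric with eigenvalue W^-2. Hence scalar products with the
    gradient of u become small on steep parts of the graph. *)
Lemma graph_metric_grad x : gm p x = dotv p x / W ^+ 2.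
Proof.
rewrite /graph_metric (dotvC x) (_ : dotv p p = W ^+ 2 - 1); last by rewrite W_sqr; ring.
by field; rewrite gt_eqF.
Qed.

Lemma graph_metric_le x : gm x x <= dotv x x.
Proof. by rewrite /graph_metric lerBlDr lerDl divr_ge0// ?sqr_ge0// -expr2 sqr_ge0. Qed.

Lemma graph_metric_cauchy_schwarz x y : gm x y ^+ 2 <= gm x x * gm y y.
Proof.
have E z t : gm z t = dotv (\row_l dotv z (graph_frame p W l)) (\row_l dotv t (graph_frame p W l)).
  by rewrite -(sum_frame W_gt0 W_sqr); apply: eq_bigr => l _; rewrite !mxE.
by rewrite !E; exact: dotv_cauchy_schwarz.
Qed.

End GraphMetric.

Section CutoffEstimates.
Context {R : realType}.
Implicit Types (W A G chi H q tau phi t d K kappa : R).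

(** The expression is m^2 Lap(phi^2 t^2), where [A], [G], [chi] are the scaled scalar products of
    the gradients of phi and x_1. Only the cross term is dangerous: its part in [q] is small since W
    t dominates phi, and its parts in [chi] and [H] are absorbed, by the arithmetic-geometric
    inequality, into t^2 [A] and phi^2 [chi]. *)
Lemma interior_cutoff_positive W A G chi H q dtau phi t d :
  0 < phi <= 1 -> 0 < t -> 100 * phi <= W * t -> `|q| * W <= 1 ->
  1 / 5 <= A -> 0 <= chi <= 1 -> H ^+ 2 <= chi -> 0 <= d <= 1 / 160 ->
  dtau <= 1 / 200 -> G = q / 2 - chi / 16 - 2 * d * H ->
  0 < 2 * t ^+ 2 * A + 8 * phi * t * G + 2 * phi ^+ 2 * chi - 4 * phi * t ^+ 2 * dtau.
Proof.
move=> /andP[phi0 phi1] t0 Wt qW A5 /andP[chi0 chi1] Hchi /andP[d0 d1] dt ->.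
have t2 : 0 < t ^+ 2 by rewrite exprn_gt0.
have p2 : 0 < phi ^+ 2 by rewrite exprn_gt0.
have tp : 0 < phi * t by rewrite mulr_gt0.
have qt : phi * `|q| <= t / 100.
  have := ler_wpM2r (normr_ge0 q) Wt; have := ler_wpM2r (ltW t0) qW.
  by rewrite -!mulrA (mulrC t) ; lra.
have h1 : - (t ^+ 2 / 25) <= 4 * (phi * t) * q.
  have : `|4 * (phi * t) * q| <= t ^+ 2 / 25.
    rewrite normrM gtr0_norm ?mulr_gt0//.
    have := ler_wpM2r (ltW t0) qt; rewrite expr2; lra.
  by rewrite ler_norml => /andP[].
have h2 : phi * t * chi <= (t ^+ 2 + phi ^+ 2 * chi) / 2.
  have : 0 <= (phi - t) ^+ 2 * chi by rewrite mulr_ge0// sqr_ge0.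
  have : t ^+ 2 * chi <= t ^+ 2 by rewrite ler_piMr// ltW.
  by rewrite sqrrB mulrDl mulrBl; lra.
have h3 : phi * t * H <= (t ^+ 2 + phi ^+ 2 * chi) / 2.
  have := sqr_ge0 (phi * H - t); have := ler_wpM2l (ltW p2) Hchi.
  by rewrite sqrrB exprMn; lra.
have h4 : d * (phi * t * H) <= (t ^+ 2 + phi ^+ 2 * chi) / 320.
  have s0 : 0 <= (t ^+ 2 + phi ^+ 2 * chi) / 2.
    by rewrite divr_ge0// addr_ge0 ?mulr_ge0// ltW.
  have := ler_wpM2l d0 h3; have := ler_wpM2r s0 d1; lra.
have h5 : phi * t ^+ 2 * dtau <= t ^+ 2 / 200.
  have a1 : phi * t ^+ 2 <= t ^+ 2 by rewrite ler_piMl// ltW.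
  have [dt0|dt0] := leP 0 dtau.
    by apply: le_trans (ler_pM _ dt0 a1 dt) _; [rewrite mulr_ge0// ltW|lra].
  have : phi * t ^+ 2 * dtau <= 0 by rewrite pmulr_rle0 ?mulr_gt0// ltW.
  lra.
have h6 : t ^+ 2 / 5 <= t ^+ 2 * A by have := ler_wpM2l (ltW t2) A5; lra.
have h7 : 0 <= phi ^+ 2 * chi by rewrite mulr_ge0// ltW.
have -> : 2 * t ^+ 2 * A + 8 * phi * t * (q / 2 - chi / 16 - 2 * d * H)
   + 2 * phi ^+ 2 * chi - 4 * phi * t ^+ 2 * dtau
  = 2 * (t ^+ 2 * A) + 4 * (phi * t) * q - (phi * t * chi) / 2 - 16 * (d * (phi * t * H))
   + 2 * (phi ^+ 2 * chi) - 4 * (phi * t ^+ 2 * dtau) by field.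
lra.
Qed.

(** Contradicts the inequality at an interior maximum: [F] and [Y] are the derivatives of eta in phi
    and t, [kappa] bounds v / W from below, and the last factor is m^2 Lap(eta). In the wedge all
    terms are comparable to powers of phi, which leaves an inequality affine in [chi]. *)
Lemma wedge_cutoff_positive A G chi dtau phi t K kappa (F Y : R) :
  F = 4 * phi ^+ 3 + 3 * phi ^+ 2 * t + 2 * K * phi * t ^+ 2 ->
  Y = phi ^+ 3 + 2 * K * phi ^+ 2 * t ->
  0 < phi <= 1 -> 0 <= t -> 4 * K * t <= phi -> 0 < kappa <= 1 -> 31 <= K * kappa ->
  1 / 5 <= A <= 1 -> 0 <= chi <= 1 -> dtau <= 1 / 200 ->
  - (A + chi) <= 2 * G ->
  (forall a b : R, 0 <= a ^+ 2 * A + 2 * a * b * G + b ^+ 2 * chi) ->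
  (F ^+ 2 * A + 2 * F * Y * G + Y ^+ 2 * chi) * chi <
  kappa * (phi ^+ 2 * (phi ^+ 2 + phi * t + K * t ^+ 2)) *
  ((12 * phi ^+ 2 + 6 * phi * t + 2 * K * t ^+ 2) * A
   + 2 * (3 * phi ^+ 2 + 4 * K * phi * t) * G + 2 * K * phi ^+ 2 * chi - 2 * F * dtau).
Proof.
move=> FE YE /andP[phi0 phi1] t0 Kt /andP[k0 k1] Kk /andP[A5 A1] /andP[chi0 chi1] dt G1 psd.
have K31 : 31 <= K.
  have K0 : 0 < K by rewrite -(pmulr_lgt0 _ k0); lra.
  by apply: le_trans Kk _; rewrite ler_piMr// ltW.
have K0 : 0 < K by lra.
have p2 : 0 < phi ^+ 2 by rewrite exprn_gt0.
have p3 : 0 < phi ^+ 3 by rewrite exprn_gt0.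
have p6 : 0 < phi ^+ 6 by rewrite exprn_gt0.
have pt : phi * t <= phi ^+ 2 / 124.
  have : 124 * t <= 4 * K * t by rewrite ler_wpM2r//; lra.
  move=> h; have := ler_wpM2l (ltW phi0) (le_trans h Kt); rewrite expr2; lra.
have pt0 : 0 <= phi * t by rewrite mulr_ge0// ltW.
have Kpt : K * (phi * t) <= phi ^+ 2 / 4.
  by have := ler_wpM2l (ltW phi0) Kt; rewrite expr2; lra.
have Kpt0 : 0 <= K * (phi * t) by rewrite mulr_ge0// ltW.
have Ktt0 : 0 <= K * t ^+ 2 by rewrite mulr_ge0 ?sqr_ge0// ltW.
have F0 : 0 <= F.
  by rewrite FE !addr_ge0// !mulr_ge0 ?exprn_ge0// ltW.
have Y0 : 0 <= Y by rewrite YE addr_ge0// ?mulr_ge0 ?exprn_ge0// ltW.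
have Ktt : K * t ^+ 2 <= phi ^+ 2 / 400.
  have t1 : t <= phi / 124.
    have : 124 * t <= 4 * K * t by rewrite ler_wpM2r//; lra.
    lra.
  have := ler_wpM2r t0 Kt; have := ler_wpM2r t0 t1 => h1 h2.
  rewrite expr2; have := pt; lra.
have F5 : F <= 5 * phi ^+ 3.
  have -> : F = phi * (4 * phi ^+ 2 + 3 * (phi * t) + 2 * (K * t ^+ 2)) by rewrite FE; ring.
  have -> : 5 * phi ^+ 3 = phi * (5 * phi ^+ 2) by ring.
  by rewrite ler_wpM2l ?ltW//; lra.
have Y2 : Y <= 2 * phi ^+ 3.
  have -> : Y = phi * (phi ^+ 2 + 2 * (K * (phi * t))) by rewrite YE; ring.
  have -> : 2 * phi ^+ 3 = phi * (2 * phi ^+ 2) by ring.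
  by rewrite ler_wpM2l ?ltW//; lra.
have F25 : F ^+ 2 <= 25 * phi ^+ 6.
  have -> : 25 * phi ^+ 6 = (5 * phi ^+ 3) ^+ 2 by ring.
  by rewrite ler_sqr ?nnegrE ?mulr_ge0// ltW.
have Y4 : Y ^+ 2 <= 4 * phi ^+ 6.
  have -> : 4 * phi ^+ 6 = (2 * phi ^+ 3) ^+ 2 by ring.
  by rewrite ler_sqr ?nnegrE ?mulr_ge0// ltW.
(* Positivity at (F, -Y) bounds the cross term by the diagonal ones, so the sum is at most twice (25
   + 4) phi^6. *)
have upper : F ^+ 2 * A + 2 * F * Y * G + Y ^+ 2 * chi <= 58 * phi ^+ 6.
  have := psd F (- Y); rewrite sqrrN => h.
  have a1 : F ^+ 2 * A <= 25 * phi ^+ 6.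
    by apply: le_trans F25; rewrite ler_piMr// sqr_ge0.
  have a2 : Y ^+ 2 * chi <= 4 * phi ^+ 6.
    by apply: le_trans Y4; rewrite ler_piMr// sqr_ge0.
  lra.
(* The cross term costs at most 4 phi^2 (A + chi), leaving 8 phi^2 A >= (8 / 5) phi^2; the [dtau]
   term takes at most phi^2 / 20. *)
have lower : phi ^+ 2 * (3 / 2 + (2 * K - 4) * chi) <=
  (12 * phi ^+ 2 + 6 * phi * t + 2 * K * t ^+ 2) * A
   + 2 * (3 * phi ^+ 2 + 4 * K * phi * t) * G + 2 * K * phi ^+ 2 * chi - 2 * F * dtau.
  have b1 : 12 * (phi ^+ 2 * A) <= (12 * phi ^+ 2 + 6 * phi * t + 2 * K * t ^+ 2) * A.
    rewrite [leRHS]mulrDl [(_ + _) * A]mulrDl -addrA -[12 * phi ^+ 2 * A]mulrA lerDl.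
    by rewrite addr_ge0// mulr_ge0//; lra.
  have b2 : - (4 * phi ^+ 2 * (A + chi)) <= 2 * (3 * phi ^+ 2 + 4 * K * phi * t) * G.
    have e1 : 3 * phi ^+ 2 + 4 * K * phi * t <= 4 * phi ^+ 2 by lra.
    have e0 : 0 <= 3 * phi ^+ 2 + 4 * K * phi * t by lra.
    have := ler_wpM2l e0 G1; have Ac : 0 <= A + chi by lra.
    have := ler_wpM2r Ac e1; lra.
  have b3 : F * dtau <= phi ^+ 2 / 40.
    have c1 : F <= 5 * phi ^+ 2.
      apply: le_trans F5 _; rewrite ler_pM2l// exprS ler_piMl// ltW//.
    have [dt0|dt0] := leP 0 dtau.
      by apply: le_trans (ler_pM F0 dt0 c1 dt) _; lra.
    by apply: le_trans (_ : 0 <= _); [rewrite mulr_ge0_le0// ltW|rewrite divr_ge0// ltW].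
  have b4 : phi ^+ 2 / 5 <= phi ^+ 2 * A by have := ler_wpM2l (ltW p2) A5; lra.
  have -> : phi ^+ 2 * (3 / 2 + (2 * K - 4) * chi) =
    3 / 2 * phi ^+ 2 + 2 * K * phi ^+ 2 * chi - 4 * (phi ^+ 2 * chi) by field.
  lra.
set Q := (X in _ <= X) in lower.
have Q0 : 0 <= phi ^+ 2 * (3 / 2 + (2 * K - 4) * chi).
  by rewrite mulr_ge0 ?ltW// ltr_wpDr// mulr_ge0//; lra.
apply: (@lt_le_trans _ _ (kappa * (phi ^+ 4) * (phi ^+ 2 * (3 / 2 + (2 * K - 4) * chi)))); last first.
  rewrite ler_pM//.
  - by rewrite mulr_ge0 ?exprn_ge0// ltW.
  - rewrite ler_pM2l// (_ : phi ^+ 4 = phi ^+ 2 * phi ^+ 2); last by ring.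
    by rewrite ler_pM2l//; lra.
apply: (@le_lt_trans _ _ (58 * phi ^+ 6 * chi)); first by rewrite ler_wpM2r.
have -> : kappa * phi ^+ 4 * (phi ^+ 2 * (3 / 2 + (2 * K - 4) * chi)) =
  phi ^+ 6 * (3 / 2 * kappa + (2 * (K * kappa) - 4 * kappa) * chi) by field.
rewrite (_ : 58 * phi ^+ 6 * chi = phi ^+ 6 * (58 * chi)); last by ring.
rewrite ltr_pM2l//.
(* The origin of 31: 2 * 31 - 4 = 58. The remaining (3 / 2) [kappa] makes the inequality strict even
   where [chi] vanishes. *)
have : 58 * chi <= (2 * (K * kappa) - 4 * kappa) * chi by rewrite ler_wpM2r//; lra.
lra.
Qed.

End CutoffEstimates.

Section Quartic.
Context {R : realType} {V : normedModType R}.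
Implicit Types (a K h t : R) (f g : V -> R) (x v : V).

(** The parameter [a] switches between the two cutoffs: a = 0, K = 1 gives h^2 t^2, and a = 1 the
    one of the wedge. *)
Definition quartic a K h t : R := h ^+ 2 * (a * h ^+ 2 + a * h * t + K * t ^+ 2).

Definition quartic_h a K h t : R := a * (4 * h ^+ 3 + 3 * h ^+ 2 * t) + 2 * K * h * t ^+ 2.

Definition quartic_t a K h t : R := a * h ^+ 3 + 2 * K * h ^+ 2 * t.

Definition quartic_hh a K h t : R := a * (12 * h ^+ 2 + 6 * h * t) + 2 * K * t ^+ 2.

Definition quartic_ht a K h t : R := 3 * a * h ^+ 2 + 4 * K * h * t.

Lemma is_derive_quartic a K f g x v (df dg : R) :
  is_derive x v f df -> is_derive x v g dg ->
  is_derive x v (fun y => quartic a K (f y) (g y))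
    (quartic_h a K (f x) (g x) * df + quartic_t a K (f x) (g x) * dg).
Proof.
move=> Hf Hg; have Hff := is_derive_mulf Hf Hf; have Hfg := is_derive_mulf Hf Hg.
have Hgg := is_derive_mulf Hg Hg.
have H := is_derive_mulf Hff (is_derive_addf (is_derive_scalef a (is_derive_addf Hff Hfg))
  (is_derive_scalef K Hgg)).
rewrite (_ : (fun y => quartic a K (f y) (g y)) = fun y => f y * f y
  * (a * (f y * f y + f y * g y) + K * (g y * g y))); last first.
  by apply/funext => y; rewrite /quartic; ring.
by apply: is_derive_eq H _; rewrite /quartic_h /quartic_t; ring.
Qed.

Lemma is_derive_quartic_h a K f g x v (df dg : R) :
  is_derive x v f df -> is_derive x v g dg ->
  is_derive x v (fun y => quartic_h a K (f y) (g y))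
    (quartic_hh a K (f x) (g x) * df + quartic_ht a K (f x) (g x) * dg).
Proof.
move=> Hf Hg; have Hff := is_derive_mulf Hf Hf; have Hfg := is_derive_mulf Hf Hg.
have Hgg := is_derive_mulf Hg Hg.
have H := is_derive_mulf Hf (is_derive_addf (is_derive_scalef (4 * a) Hff)
  (is_derive_addf (is_derive_scalef (3 * a) Hfg) (is_derive_scalef (2 * K) Hgg))).
rewrite (_ : (fun y => quartic_h a K (f y) (g y)) = fun y => f y
  * (4 * a * (f y * f y) + (3 * a * (f y * g y) + 2 * K * (g y * g y)))); last first.
  by apply/funext => y; rewrite /quartic_h; ring.
by apply: is_derive_eq H _; rewrite /quartic_hh /quartic_ht; ring.
Qed.

Lemma is_derive_quartic_t a K f g x v (df dg : R) :
  is_derive x v f df -> is_derive x v g dg ->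
  is_derive x v (fun y => quartic_t a K (f y) (g y))
    (quartic_ht a K (f x) (g x) * df + 2 * K * f x ^+ 2 * dg).
Proof.
move=> Hf Hg; have Hff := is_derive_mulf Hf Hf.
have H := is_derive_mulf Hff (is_derive_addf (is_derive_scalef a Hf)
  (is_derive_scalef (2 * K) Hg)).
rewrite (_ : (fun y => quartic_t a K (f y) (g y)) = fun y => f y * f y
  * (a * f y + 2 * K * g y)); last first.
  by apply/funext => y; rewrite /quartic_t; ring.
by apply: is_derive_eq H _; rewrite /quartic_ht; ring.
Qed.

End Quartic.

Section Cutoff.
Context {R : realType} {n : nat} (u : 'rV[R]_n.+1 -> R).
Context (smooth_u : smooth_up_to_boundary u).
Context (s C d m : R) (m_gt0 : 0 < m).
Implicit Types (x y b : 'rV[R]_n.+1) (a K c : R).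
Local Notation W := (area_element u).
Local Notation dir := (dir_deriv u).
Local Notation e0 := (basis_vector ord0).

Definition normal_depth y : R := y ord0 ord0 / m.

Definition level y : R :=
  1 + s / (2 * m) * (u y - C) - normal_depth y / 16 - (d / m) ^+ 2 * dotv y y.

Definition dlevel b y : R :=
  s / (2 * m) * dir b [::] y - b ord0 ord0 / m / 16 - 2 * (d / m) ^+ 2 * dotv y b.

Definition d2level b x : R :=
  s / (2 * m) * dir_deriv2 u b [::] x - 2 * (d / m) ^+ 2 * dotv b b.

(** m times the differential of [level]; with this scaling its bounds are free of m. *)
Definition level_covector x : 'rV[R]_n.+1 :=
  (s / 2) *: grad u x + (- (1 / 16)) *: e0 + (- (2 * d ^+ 2 / m)) *: x.

Lemma is_derive_depth x b : is_derive x b normal_depth (b ord0 ord0 / m).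
Proof.
rewrite (_ : normal_depth = fun y => m^-1 * y ord0 ord0); last first.
  by apply/funext => y; rewrite mulrC.
by rewrite mulrC; apply: is_derive_scalef; exact: is_derive_coord.
Qed.

Lemma is_derive_dotvr x b y : is_derive x b (fun z => dotv z y) (dotv b y).
Proof.
apply: is_derive_sumf => i; rewrite mulrC.
have H := is_derive_scalef (y ord0 i) (is_derive_coord x b i).
by rewrite (_ : (fun z : 'rV[R]_n.+1 => _) = fun z => y ord0 i * z ord0 i)//;
  apply/funext => z; rewrite mulrC.
Qed.

Lemma is_derive_dotvv x b : is_derive x b (fun y => dotv y y) (2 * dotv x b).
Proof.
rewrite /dotv mulr_sumr; apply: is_derive_sumf => i.
apply: is_derive_eq (is_derive_mulf (is_derive_coord x b i) (is_derive_coord x b i)) _.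
by ring.
Qed.

Lemma is_derive_level b x : derivable_along u b x -> is_derive x b level (dlevel b x).
Proof.
move=> xA; rewrite (_ : level = fun y => (1 - s / (2 * m) * C) + (s / (2 * m) * u y +
   (- (1 / 16) * normal_depth y + - (d / m) ^+ 2 * dotv y y))); last first.
  by apply/funext => y; rewrite /level; field; rewrite gt_eqF.
have H := is_derive_addf (is_derive_cst (1 - s / (2 * m) * C) x b)
  (is_derive_addf (is_derive_scalef (s / (2 * m)) (xA [::]))
    (is_derive_addf (is_derive_scalef (- (1 / 16)) (is_derive_depth x b))
      (is_derive_scalef (- (d / m) ^+ 2) (is_derive_dotvv x b)))).
by apply: is_derive_eq H _; rewrite /dlevel; field; rewrite gt_eqF.
Qed.

Lemma is_derive_dlevel b x : half_space R n x -> is_derive x b (dlevel b) (d2level b x).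
Proof.
move=> xU; rewrite (_ : dlevel b = fun y => (- (b ord0 ord0 / m / 16)) + (s / (2 * m) * dir b [::] y +
   - 2 * (d / m) ^+ 2 * dotv y b)); last first.
  by apply/funext => y; rewrite /dlevel; field; rewrite gt_eqF.
have H := is_derive_addf (is_derive_cst (- (b ord0 ord0 / m / 16)) x b)
  (is_derive_addf (is_derive_scalef (s / (2 * m)) (is_derive_dir smooth_u b [::] xU))
      (is_derive_scalef (- 2 * (d / m) ^+ 2) (is_derive_dotvr x b b))).
by apply: is_derive_eq H _; rewrite /d2level; field; rewrite gt_eqF.
Qed.

Lemma dlevel_covector b x : dlevel b x = dotv (level_covector x) b / m.
Proof.
rewrite /dlevel /level_covector !dotvDl !dotvZl dir_derivE [dotv e0 b]dotvC dotv_delta.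
by field; rewrite gt_eqF.
Qed.

Definition cutoff a K y := quartic a K (level y) (normal_depth y).

Definition dcutoff a K b y :=
  quartic_h a K (level y) (normal_depth y) * dlevel b y
  + quartic_t a K (level y) (normal_depth y) * (b ord0 ord0 / m).

Definition d2cutoff a K x b :=
  (quartic_hh a K (level x) (normal_depth x) * dlevel b x
     + quartic_ht a K (level x) (normal_depth x) * (b ord0 ord0 / m)) * dlevel b x
  + quartic_h a K (level x) (normal_depth x) * d2level b x
  + (quartic_ht a K (level x) (normal_depth x) * dlevel b x
     + 2 * K * level x ^+ 2 * (b ord0 ord0 / m)) * (b ord0 ord0 / m).

Lemma is_derive_cutoff a K b x : derivable_along u b x ->
  is_derive x b (cutoff a K) (dcutoff a K b x).
Proof.
by move=> xA; apply: is_derive_quartic; [exact: is_derive_level|exact: is_derive_depth].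
Qed.

Lemma is_derive_dcutoff a K b x : half_space R n x ->
  is_derive x b (dcutoff a K b) (d2cutoff a K x b).
Proof.
move=> xU; have xA := smooth_derivable_along smooth_u b xU.
have [Hc Hd] := (is_derive_level xA, is_derive_depth x b).
have H := is_derive_addf
  (is_derive_mulf (is_derive_quartic_h a K Hc Hd) (is_derive_dlevel b xU))
  (is_derive_mulf (is_derive_quartic_t a K Hc Hd) (is_derive_cst (b ord0 ord0 / m) x b)).
by apply: is_derive_eq H _; rewrite /d2cutoff mulr0 addr0.
Qed.

Definition cutoff_covector a K x : 'rV[R]_n.+1 :=
  m^-1 *: (quartic_h a K (level x) (normal_depth x) *: level_covector x
           + quartic_t a K (level x) (normal_depth x) *: e0).

Lemma dcutoff_covector a K b x : dcutoff a K b x = dotv (cutoff_covector a K x) b.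
Proof.
rewrite /dcutoff /cutoff_covector dlevel_covector.
have -> : b ord0 ord0 = dotv e0 b by rewrite dotvC dotv_delta.
by move: (level_covector x) e0 => al e; rewrite dotvZl dotvDl !dotvZl; ring.
Qed.

Local Notation gm x := (graph_metric (grad u x) (W x)).

(** Half the Laplacian of |x|^2 on the graph. *)
Definition frame_trace x : R :=
  \sum_l dotv (graph_frame (grad u x) (W x) l) (graph_frame (grad u x) (W x) l).

Lemma frame_trace_le x : frame_trace x <= n.+1%:R.
Proof.
have W0 := area_element_gt0 u x; have W2 := area_element_dotv u x.
have := sum_quadf_frame W0 W2 1%:M.
under eq_bigr do rewrite /quadf mulmx1.
rewrite -/(frame_trace x) => ->.
by rewrite mxtrace1 lerBlDr lerDl divr_ge0// ?sqr_ge0// /quadf mulmx1 dotvv_ge0.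
Qed.

Context (minimal_u : forall x, half_space R n x ->
  divergence (fun y => (W y)^-1 *: grad u y) x = 0).

(** The chain rule for m^2 Lap(eta). As u and x_1 are harmonic, only the quadratic term of phi
    contributes to Lap(phi). *)
Lemma sum_d2cutoff a K x : half_space R n x ->
  m ^+ 2 * \sum_l d2cutoff a K x (graph_frame (grad u x) (W x) l) =
  quartic_hh a K (level x) (normal_depth x) * gm x (level_covector x) (level_covector x)
  + 2 * quartic_ht a K (level x) (normal_depth x) * gm x (level_covector x) e0
  + 2 * K * level x ^+ 2 * gm x e0 e0
  - quartic_h a K (level x) (normal_depth x) * (2 * d ^+ 2 * frame_trace x).
Proof.
move=> xU; have W0 := area_element_gt0 u x; have W2 := area_element_dotv u x.
have sumf := sum_frame W0 W2; rewrite -!sumf /frame_trace.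
set q := quartic_hh _ _ _ _; set q' := quartic_ht _ _ _ _; set q'' := quartic_h _ _ _ _.
set b := graph_frame _ _; set al := level_covector x.
have harm : \sum_l dir_deriv2 u (b l) [::] x = 0.
  under eq_bigr do rewrite dir_deriv2_hess (trmx_hess smooth_u (half_space_closed xU)).
  rewrite (sum_quadf_frame W0 W2) -(minimal_hess smooth_u minimal_u xU).
  by rewrite mulfK ?subrr// expf_neq0// gt_eqF.
rewrite mulr_sumr.
rewrite (eq_bigr (fun l => q * (dotv al (b l) * dotv al (b l))
  + 2 * q' * (dotv al (b l) * dotv e0 (b l))
  + 2 * K * level x ^+ 2 * (dotv e0 (b l) * dotv e0 (b l))
  - q'' * (2 * d ^+ 2) * dotv (b l) (b l)
  + q'' * (s * m / 2) * dir_deriv2 u (b l) [::] x)); last first.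
  move=> l _; rewrite /d2cutoff -/q -/q' -/q'' dlevel_covector -/al /d2level.
  have -> : b l ord0 ord0 = dotv e0 (b l) by rewrite dotvC dotv_delta.
  by field; rewrite gt_eqF.
by rewrite !big_split/= sumrN -!mulr_sumr harm; ring.
Qed.

Context (s_sqr : s ^+ 2 = 1) (d_bound : 0 <= d <= 1 / 160).

Lemma chi_bounds x : 0 <= gm x e0 e0 <= 1.
Proof.
rewrite (graph_metricvv_ge0 (area_element_gt0 u x) (area_element_dotv u x))/=.
by apply: le_trans (graph_metric_le _ _ _) _; rewrite dotv_delta mxE !eqxx.
Qed.

Lemma normal_slope_bound x : `|grad u x ord0 ord0| <= W x.
Proof.
rewrite -(ger0_norm (ltW (area_element_gt0 u x))) -ler_sqr ?nnegrE//.
rewrite !real_normK ?num_real// area_element_dotv /dotv (bigD1 ord0)//= -expr2.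
by rewrite addrCA lerDl addr_ge0// sumr_ge0// => i _; rewrite -expr2 sqr_ge0.
Qed.

(** H is d / m times the scalar product of x and e_1 in the inverse metric. Cauchy-Schwarz bounds
    its square by |grad x_1|^2 and not merely by a constant, which matters where |grad x_1| is
    small. *)
Lemma level_covector_chi x : dotv x x * (d / m) ^+ 2 <= 1 -> exists2 H : R,
  H ^+ 2 <= gm x e0 e0 &
  gm x (level_covector x) e0
    = (s * grad u x ord0 ord0 / W x ^+ 2) / 2 - gm x e0 e0 / 16 - 2 * d * H.
Proof.
move=> xd; have W0 := area_element_gt0 u x; have W2 := area_element_dotv u x.
exists (d / m * gm x x e0).
  have chi0 : 0 <= gm x e0 e0 by case/andP: (chi_bounds x).
  rewrite exprMn; apply: le_trans (_ : (d / m) ^+ 2 * (gm x x x * gm x e0 e0) <= _).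
    by rewrite ler_wpM2l ?sqr_ge0//; exact: graph_metric_cauchy_schwarz.
  rewrite mulrA ler_piMl//; apply: le_trans xd; rewrite mulrC ler_wpM2r ?sqr_ge0//.
  exact: graph_metric_le.
rewrite /level_covector !graph_metricDl !graph_metricZl (graph_metric_grad W0 W2) dotv_delta.
by field; rewrite !gt_eqF.
Qed.

(** The part s p / 2 has squared length (1 - W^-2) / 4, close to 1 / 4. The remainder [r] has
    squared length at most 1 / 100, and its product with p is of order 1 / W by
    [graph_metric_grad]. *)
Lemma level_covector_bounds x : dotv x x * (d / m) ^+ 2 <= 1 -> 8 <= W x ->
  1 / 5 <= gm x (level_covector x) (level_covector x) <= 1.
Proof.
move=> xd W8; have W0 := area_element_gt0 u x; have W2 := area_element_dotv u x.
have m0 : m != 0 by rewrite gt_eqF.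
have [d0 d1] : 0 <= d /\ d <= 1 / 160 by case/andP: d_bound.
set p := grad u x in W2 *; set w := W x in W0 W2 W8 *.
have [r rE] : {r | r = (1 / 16) *: e0 + (2 * d ^+ 2 / m) *: x} by eexists.
have -> : level_covector x = (s / 2) *: p + (- 1) *: r.
  by rewrite /level_covector rE scalerDr !scalerA !mulN1r addrA.
have -> : graph_metric p w ((s / 2) *: p + (- 1) *: r) ((s / 2) *: p + (- 1) *: r)
  = (dotv p p / w ^+ 2) / 4 * s ^+ 2 - s * (dotv p r / w ^+ 2) + graph_metric p w r r.
  rewrite !(graph_metricDl, graph_metricDr, graph_metricZl, graph_metricZr).
  by rewrite (graph_metricC _ _ r p) !(graph_metric_grad W0 W2); field; rewrite gt_eqF.
pose k := d / m * dotv p x.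
have kw : `|k| <= w.
  rewrite -(ger0_norm (ltW W0)) -ler_sqr ?nnegrE// !real_normK ?num_real//.
  rewrite /k exprMn; apply: le_trans (_ : (d / m) ^+ 2 * (dotv p p * dotv x x) <= _).
    by rewrite ler_wpM2l ?sqr_ge0//; exact: dotv_cauchy_schwarz.
  rewrite mulrCA mulrC; apply: le_trans (_ : dotv p p <= _).
    by rewrite mulrC ler_piMr ?dotvv_ge0// mulrC.
  by rewrite W2 lerDr.
have pr : dotv p r = p ord0 ord0 / 16 + 2 * d * k.
  by rewrite rE dotvDr !dotvZr dotv_delta /k; field.
have rr : graph_metric p w r r <= 1 / 100.
  apply: le_trans (graph_metric_le _ _ _) _.
  have -> : dotv r r = 1 / 256 + d ^+ 2 / (4 * m) * x ord0 ord0
      + 4 * d ^+ 2 * (dotv x x * (d / m) ^+ 2).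
    rewrite rE !(dotvDl, dotvDr, dotvZl, dotvZr) (dotvC e0 x) !dotv_delta mxE !eqxx.
    by rewrite /= mulr1n; field.
  have x0d : `|d / m * x ord0 ord0| <= 1.
    rewrite -[leRHS](ger0_norm ler01) -ler_sqr ?nnegrE// !real_normK ?num_real// expr1n.
    apply: le_trans xd; rewrite exprMn mulrC ler_wpM2r ?sqr_ge0//.
    by rewrite /dotv (bigD1 ord0)//= -expr2 lerDl sumr_ge0// => i _; rewrite -expr2 sqr_ge0.
  have -> : d ^+ 2 / (4 * m) * x ord0 ord0 = d / 4 * (d / m * x ord0 ord0) by field.
  have h1 : d / 4 * (d / m * x ord0 ord0) <= d / 4.
    by rewrite ler_piMr ?divr_ge0//; case/andP: (etrans (esym (ler_norml _ _)) x0d).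
  have h2 : 4 * d ^+ 2 * (dotv x x * (d / m) ^+ 2) <= 4 * d ^+ 2.
    by rewrite ler_piMr// mulr_ge0 ?sqr_ge0.
  have h3 : d ^+ 2 <= 1 / 160 * (1 / 160) by rewrite expr2 ler_pM.
  lra.
have rr0 := graph_metricvv_ge0 W0 W2 r.
have w2 : w ^+ 2 != 0 by rewrite expf_neq0// gt_eqF.
have pp : dotv p p / w ^+ 2 = 1 - 1 / w ^+ 2.
  by rewrite (_ : dotv p p = w ^+ 2 - 1); [field; rewrite gt_eqF|rewrite W2; ring].
have iw : 1 / w <= 1 / 8 by rewrite !div1r lef_pV2// posrE.
have iw0 : 0 < 1 / w by rewrite div1r invr_gt0.
have iw2 : 1 / w ^+ 2 <= 1 / 64.
  have -> : 1 / w ^+ 2 = (1 / w) * (1 / w) by field; rewrite gt_eqF.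
  by apply: le_trans (ler_pM (ltW iw0) (ltW iw0) iw iw) _; lra.
have prw : `|s * (dotv p r / w ^+ 2)| <= 1 / 100.
  have s1 : `|s| = 1 by apply/eqP; rewrite -sqrp_eq1// real_normK ?num_real// s_sqr.
  rewrite normrM s1 [leLHS]mul1r normrM (ger0_norm (_ : 0 <= (w ^+ 2)^-1)) ?invr_ge0 ?sqr_ge0//.
  have : `|dotv p r| <= w * (3 / 40).
    rewrite pr; apply: le_trans (ler_normD _ _) _.
    have a1 : `|p ord0 ord0 / 16| <= w / 16.
      by rewrite normrM ler_pM//; [exact: normal_slope_bound|rewrite ger0_norm].
    have a2 : `|2 * d * k| <= 1 / 80 * w.
      rewrite normrM ler_pM//; first by rewrite ger0_norm ?mulr_ge0//; lra.
    lra.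
  move=> h; have iw20 : 0 <= (w ^+ 2)^-1 by rewrite invr_ge0 sqr_ge0.
  apply: le_trans (ler_wpM2r iw20 h) _.
  have -> : w * (3 / 40) / w ^+ 2 = 3 / 40 * (1 / w) by field; rewrite gt_eqF.
  lra.
rewrite s_sqr pp mulr1; move: prw; rewrite ler_norml => /andP[b1 b2].
have iw20 : 0 <= 1 / w ^+ 2 by rewrite divr_ge0 ?sqr_ge0.
by apply/andP; split; lra.
Qed.

End Cutoff.

(** * Continuity up to the boundary *)

Section ContinuityUpToBoundary.
Context {R : realType} {n : nat} (u : 'rV[R]_n.+1 -> R).
Context (smooth_u : smooth_up_to_boundary u).
Implicit Types (f g : 'rV[R]_n.+1 -> R) (x b : 'rV[R]_n.+1).
Local Notation W := (area_element u).

Lemma cont_to_boundary_within f :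
  cont_to_boundary f <-> {within closed_half_space R n, continuous f}.
Proof. by split=> [H|/subspace_continuousP//]; apply/subspace_continuousP. Qed.

Lemma cont_to_boundaryD f g : cont_to_boundary f -> cont_to_boundary g ->
  cont_to_boundary (fun y => f y + g y).
Proof. by move=> cf cg x xC; apply: cvgD; [exact: cf|exact: cg]. Qed.

Lemma cont_to_boundaryM f g : cont_to_boundary f -> cont_to_boundary g ->
  cont_to_boundary (fun y => f y * g y).
Proof. by move=> cf cg x xC; apply: cvgM; [exact: cf|exact: cg]. Qed.

Lemma cont_to_boundary_cst (k : R) : cont_to_boundary (fun _ : 'rV[R]_n.+1 => k).
Proof. by move=> x xC; exact: cvg_cst. Qed.

Lemma cont_to_boundary_comp (k : R -> R) f : cont_to_boundary f ->
  (forall x, closed_half_space R n x -> {for f x, continuous k}) ->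
  cont_to_boundary (fun y => k (f y)).
Proof.
by move=> cf ck x xC; apply: (@cvg_comp _ _ _ f k _ (nbhs (f x))); [exact: cf|exact: ck].
Qed.

Lemma cont_to_boundary_sum (I : Type) (r : seq I) (h : I -> 'rV[R]_n.+1 -> R) :
  (forall i, cont_to_boundary (h i)) ->
  cont_to_boundary (fun y => \sum_(i <- r) h i y).
Proof.
move=> ch; elim: r => [|i r IH].
  by under [X in cont_to_boundary X]eq_fun do rewrite big_nil; exact: cont_to_boundary_cst.
under [X in cont_to_boundary X]eq_fun do rewrite big_cons.
exact: cont_to_boundaryD.
Qed.

Lemma cont_to_boundary_coord i : cont_to_boundary (fun y : 'rV[R]_n.+1 => y ord0 i).
Proof. by move=> x xC; apply: cvg_within_filter; exact: coord_continuous. Qed.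

Lemma cont_to_boundary_iter s : cont_to_boundary (iter_partial s u).
Proof. by move=> x xC; exact: smooth_cvg. Qed.

Lemma cont_to_boundary_area : cont_to_boundary W.
Proof.
rewrite (_ : W = fun y => Num.sqrt (1 + \sum_k iter_partial [:: k] u y * iter_partial [:: k] u y));
  last first.
  by apply/funext => y; rewrite -area_element_sqrM sqrtr_sqr ger0_norm// ltW// area_element_gt0.
apply: cont_to_boundary_comp => [|x _]; last exact: sqrt_continuous.
apply: cont_to_boundaryD; first exact: cont_to_boundary_cst.
by apply: cont_to_boundary_sum => k; apply: cont_to_boundaryM; exact: cont_to_boundary_iter.
Qed.

Lemma cont_to_boundary_dir b s : cont_to_boundary (dir_deriv u b s).
Proof.
apply: cont_to_boundary_sum => i; apply: cont_to_boundaryM; last exact: cont_to_boundary_iter.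
exact: cont_to_boundary_cst.
Qed.

Lemma cont_to_boundary_darea b : cont_to_boundary (darea u b).
Proof.
apply: cont_to_boundaryM.
  apply: cont_to_boundary_sum => k.
  by apply: cont_to_boundaryM; [exact: cont_to_boundary_iter|exact: cont_to_boundary_dir].
apply: cont_to_boundary_comp; first exact: cont_to_boundary_area.
by move=> x _; apply: inv_continuous; rewrite gt_eqF// area_element_gt0.
Qed.

Lemma cont_to_boundary_capillary_fun c : cont_to_boundary (capillary_fun u c).
Proof.
apply: cont_to_boundaryD; first exact: cont_to_boundary_area.
apply: cont_to_boundaryM; first exact: cont_to_boundary_cst.
exact: cont_to_boundary_iter.
Qed.

Lemma cont_to_boundary_dcapillary_fun c b : cont_to_boundary (dcapillary_fun u c b).
Proof.
apply: cont_to_boundaryD; first exact: cont_to_boundary_darea.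
apply: cont_to_boundaryM; first exact: cont_to_boundary_cst.
exact: cont_to_boundary_dir.
Qed.

Context (s C d m : R).

Lemma cont_to_boundary_depth : cont_to_boundary (@normal_depth R n m).
Proof.
by apply: cont_to_boundaryM; [exact: cont_to_boundary_coord|exact: cont_to_boundary_cst].
Qed.

Lemma cont_to_boundary_dotv (f g : 'rV[R]_n.+1 -> 'rV[R]_n.+1) :
  (forall i, cont_to_boundary (fun y => f y ord0 i)) ->
  (forall i, cont_to_boundary (fun y => g y ord0 i)) ->
  cont_to_boundary (fun y => dotv (f y) (g y)).
Proof. by move=> cf cg; apply: cont_to_boundary_sum => i; exact: cont_to_boundaryM. Qed.

Lemma cont_to_boundary_level : cont_to_boundary (level u s C d m).
Proof.
rewrite (_ : level u s C d m = fun y => 1 + s / (2 * m) * (iter_partial [::] u y + - C)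
   + normal_depth m y * (- (16^-1)) + - (d / m) ^+ 2 * dotv y y); last first.
  by apply/funext => y; rewrite /level /=; ring.
apply: cont_to_boundaryD; last first.
  apply: cont_to_boundaryM; first exact: cont_to_boundary_cst.
  by apply: cont_to_boundary_dotv => i; exact: cont_to_boundary_coord.
apply: cont_to_boundaryD; last first.
  by apply: cont_to_boundaryM; [exact: cont_to_boundary_depth|exact: cont_to_boundary_cst].
apply: cont_to_boundaryD; first exact: cont_to_boundary_cst.
apply: cont_to_boundaryM; first exact: cont_to_boundary_cst.
apply: cont_to_boundaryD; last exact: cont_to_boundary_cst.
exact: cont_to_boundary_iter.
Qed.

Lemma cont_to_boundary_dlevel b : cont_to_boundary (dlevel u s d m b).
Proof.
rewrite (_ : dlevel u s d m b = fun y => s / (2 * m) * dir_deriv u b [::] y + - (b ord0 ord0 / m / 16)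
   + - (2 * (d / m) ^+ 2) * dotv y b); last first.
  by apply/funext => y; rewrite /dlevel /=; ring.
apply: cont_to_boundaryD; last first.
  apply: cont_to_boundaryM; first exact: cont_to_boundary_cst.
  apply: cont_to_boundary_dotv => i; first exact: cont_to_boundary_coord.
  exact: cont_to_boundary_cst.
apply: cont_to_boundaryD; last exact: cont_to_boundary_cst.
apply: cont_to_boundaryM; first exact: cont_to_boundary_cst.
exact: cont_to_boundary_dir.
Qed.

Lemma cont_to_boundaryX f k : cont_to_boundary f -> cont_to_boundary (fun y => f y ^+ k).
Proof. by move=> cf; apply: (cont_to_boundary_comp (k := fun r => r ^+ k) cf) => x _; exact: exprn_continuous. Qed.

Section QuarticContinuity.
Context (f g : 'rV[R]_n.+1 -> R) (a K : R).
Context (cf : cont_to_boundary f) (cg : cont_to_boundary g).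
Local Notation cA := cont_to_boundaryD.
Local Notation cM := cont_to_boundaryM.
Local Notation cX k := (@cont_to_boundaryX _ k).
Local Notation cC := (@cont_to_boundary_cst).

Lemma cont_to_boundary_quartic : cont_to_boundary (fun y => quartic a K (f y) (g y)).
Proof.
rewrite /quartic.
refine (cM (cX 2 cf) (cA (cA (cM (cC a) (cX 2 cf)) (cM (cM (cC a) cf) cg))
  (cM (cC K) (cX 2 cg)))).
Qed.

Lemma cont_to_boundary_quartic_h : cont_to_boundary (fun y => quartic_h a K (f y) (g y)).
Proof.
rewrite /quartic_h.
refine (cA (cM (cC a) (cA (cM (cC 4) (cX 3 cf)) (cM (cM (cC 3) (cX 2 cf)) cg)))
  (cM (cM (cC (2 * K)) cf) (cX 2 cg))).
Qed.

Lemma cont_to_boundary_quartic_t : cont_to_boundary (fun y => quartic_t a K (f y) (g y)).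
Proof.
rewrite /quartic_t.
refine (cA (cM (cC a) (cX 3 cf)) (cM (cM (cC (2 * K)) (cX 2 cf)) cg)).
Qed.

End QuarticContinuity.

Lemma cont_to_boundary_cutoff a K : cont_to_boundary (cutoff u s C d m a K).
Proof. exact: cont_to_boundary_quartic cont_to_boundary_level cont_to_boundary_depth. Qed.

Lemma cont_to_boundary_dcutoff a K b : cont_to_boundary (dcutoff u s C d m a K b).
Proof.
apply: cont_to_boundaryD.
  apply: cont_to_boundaryM; last exact: cont_to_boundary_dlevel.
  exact: cont_to_boundary_quartic_h cont_to_boundary_level cont_to_boundary_depth.
apply: cont_to_boundaryM; last exact: cont_to_boundary_cst.
exact: cont_to_boundary_quartic_t cont_to_boundary_level cont_to_boundary_depth.
Qed.

End ContinuityUpToBoundary.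

(** * The maximum principle *)

Lemma closed_superlevel (R : realType) (n : nat) (f : 'rV[R]_n.+1 -> R) :
  cont_to_boundary f -> closed [set y | closed_half_space R n y /\ 0 <= f y].
Proof.
move=> cf x xcl.
have xC : closed_half_space R n x.
  apply: closed_closed_half_space => B /xcl[y [[yC _] By]].
  by exists y.
split=> //; rewrite leNgt; apply/negP => fx0.
have /cvgr_lt/(_ 0 fx0) := cf x xC.
by move=> /xcl[y [[yC fy] /(_ yC)]]; rewrite ltNge fy.
Qed.

Section GradientBound.
Context {R : realType} {n : nat} (u : 'rV[R]_n.+1 -> R).
Context (smooth_u : smooth_up_to_boundary u).
Context (minimal_u : forall x, half_space R n x ->
  divergence (fun y => (area_element u y)^-1 *: grad u y) x = 0).
Context (s C d m : R) (m_gt0 : 0 < m) (s_sqr : s ^+ 2 = 1).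
Context (d_gt0 : 0 < d) (d_le : d <= 1 / 160) (d_sqr_le : d ^+ 2 * n.+1%:R <= 1 / 200).
Context (u_le : forall y, closed_half_space R n y -> s * (u y - C) <= 0).
Implicit Types (x y b : 'rV[R]_n.+1) (a K c : R).
Local Notation W := (area_element u).
Local Notation phi := (level u s C d m).
Local Notation depth := (@normal_depth R n m).
Local Notation e0 := (basis_vector ord0).
Local Notation gm x := (graph_metric (grad u x) (W x)).

Lemma depth_ge0 y : closed_half_space R n y -> 0 <= depth y.
Proof. by move=> yC; rewrite divr_ge0// ltW. Qed.

(** Here the one-sided bound on u enters: its term in phi is nonpositive, so the quadratic term
    confines {phi >= 0} to a bounded set. *)
Lemma level_decomp y : closed_half_space R n y ->
  phi y + depth y / 16 + dotv y y * (d / m) ^+ 2 <= 1.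
Proof.
move=> yC; rewrite /level.
have -> : s / (2 * m) * (u y - C) = s * (u y - C) / (2 * m) by rewrite mulrAC.
have : s * (u y - C) / (2 * m) <= 0.
  by rewrite pmulr_lle0 ?u_le// invr_gt0 mulr_gt0.
rewrite [_ ^+ 2 * _]mulrC; lra.
Qed.

Lemma level_le1 y : closed_half_space R n y -> phi y <= 1.
Proof.
move=> yC; have := level_decomp yC; have := depth_ge0 yC.
have : 0 <= dotv y y * (d / m) ^+ 2 by rewrite mulr_ge0 ?dotvv_ge0 ?sqr_ge0.
lra.
Qed.

Lemma depth_le y : closed_half_space R n y -> 0 <= phi y -> depth y <= 16.
Proof.
move=> yC; have := level_decomp yC.
have : 0 <= dotv y y * (d / m) ^+ 2 by rewrite mulr_ge0 ?dotvv_ge0 ?sqr_ge0.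
lra.
Qed.

Lemma dotv_level_le y : closed_half_space R n y -> 0 <= phi y ->
  dotv y y * (d / m) ^+ 2 <= 1.
Proof. by move=> yC; have := level_decomp yC; have := depth_ge0 yC; lra. Qed.

Lemma compact_level (A : set 'rV[R]_n.+1) : closed A ->
  A `<=` [set y | closed_half_space R n y /\ 0 <= phi y] -> compact A.
Proof.
move=> Acl AE.
have boxc : compact [set v : 'rV[R]_n.+1 | forall i, v ord0 i \in `[(- (m / d)), (m / d)]].
  apply: (@rV_compact _ _ (fun=> `[(- (m / d)), (m / d)]%classic)).
  by move=> _; exact: segment_compact.
apply: subclosed_compact Acl boxc _ => y /AE[yC phiy] i.
have md0 : 0 <= m / d by rewrite divr_ge0// ltW.
rewrite in_itv/= -ler_norml -[leRHS](ger0_norm md0) -ler_sqr ?nnegrE// !real_normK ?num_real//.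
have h : y ord0 i ^+ 2 <= dotv y y.
  rewrite /dotv (bigD1 i)//= -expr2 lerDl sumr_ge0// => j _.
  by rewrite -expr2 sqr_ge0.
have := dotv_level_le yC phiy; rewrite -ler_pdivlMr ?exprn_gt0 ?divr_gt0//.
by rewrite div1r -exprVn invf_div; exact: le_trans.
Qed.

Lemma near_level x (f : 'rV[R]_n.+1 -> R) : half_space R n x -> cont_to_boundary f -> 0 < f x ->
  \forall y \near x, closed_half_space R n y /\ 0 < f y.
Proof.
move=> xU cf fx0; have /cvgr_gt/(_ 0 fx0) := cf x (half_space_closed xU).
rewrite near_withinE => H; near=> y.
have yC : closed_half_space R n y by apply: half_space_closed; near: y; exact: near_half_space.
by split=> //; apply: (near H y).
Unshelve. all: by end_near. Qed.

Lemma half_space_depth x : 0 < depth x -> half_space R n x.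
Proof. by rewrite /normal_depth pmulr_lgt0// invr_gt0. Qed.

(** [interior_max_cutoff] for a quartic in phi and t, multiplied by m^2 to cancel the scale. The
    defining equations let the caller abstract the five quantities. *)
Lemma interior_max_level a K c x (F Y A G chi : R) :
  F = quartic_h a K (phi x) (depth x) -> Y = quartic_t a K (phi x) (depth x) ->
  A = gm x (level_covector u s d m x) (level_covector u s d m x) ->
  G = gm x (level_covector u s d m x) e0 -> chi = gm x e0 e0 ->
  half_space R n x ->
  0 < cutoff u s C d m a K x ->
  (\forall y \near x, cutoff u s C d m a K y * capillary_fun u c y
      <= cutoff u s C d m a K x * capillary_fun u c x) ->
  capillary_fun u c x * cutoff u s C d m a K x *
    (quartic_hh a K (phi x) (depth x) * A + 2 * quartic_ht a K (phi x) (depth x) * G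
      + 2 * K * phi x ^+ 2 * chi - F * (2 * d ^+ 2 * frame_trace u x))
  <= c ^+ 2 * W x * (F ^+ 2 * A + 2 * F * Y * G + Y ^+ 2 * chi) * chi.
Proof.
move=> FE YE AE GE chiE xU eta0 xmax.
have := interior_max_cutoff smooth_u minimal_u xU
  (fun b => _) (fun b => is_derive_dcutoff smooth_u s C d m_gt0 a K b xU)
  (fun b => dcutoff_covector u s C d m_gt0 a K b x) eta0 xmax.
have H1 b : \forall y \near x, is_derive y b (cutoff u s C d m a K) (dcutoff u s C d m a K b y).
  near=> y; apply: is_derive_cutoff => //; apply: smooth_derivable_along => //.
  by near: y; exact: near_half_space.
move=> /(_ H1) H; have m2 : 0 < m ^+ 2 by rewrite exprn_gt0.
rewrite FE AE GE chiE -sum_d2cutoff// mulrCA -FE -AE -GE -chiE.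
have -> : c ^+ 2 * W x * (F ^+ 2 * A + 2 * F * Y * G + Y ^+ 2 * chi) * chi
  = m ^+ 2 * (c ^+ 2 * W x * gm x (cutoff_covector u s C d m a K x)
       (cutoff_covector u s C d m a K x) * chi).
  rewrite /cutoff_covector -FE -YE.
  move: (level_covector u s d m x) e0 AE GE chiE => al e AE GE chiE.
  rewrite graph_metricZl graph_metricZr.
  rewrite !(graph_metricDl, graph_metricDr, graph_metricZl, graph_metricZr) -AE -chiE.
  rewrite (graph_metricC _ _ e) -GE; field; rewrite gt_eqF//.
by rewrite ler_pM2l// chiE; exact: H.
Unshelve. all: by end_near. Qed.

(** The product vanishes for phi = 0 and for t = 0, so only a maximum point interior to {phi > 0, t
    > 0} matters. *)
Lemma interior_estimate y : closed_half_space R n y -> 0 <= phi y ->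
  W y * (phi y ^+ 2 * depth y ^+ 2) <= 2048.
Proof.
move=> yC phiy.
have E z : cutoff u s C d m 0 1 z * capillary_fun u 0 z = W z * (phi z ^+ 2 * depth z ^+ 2).
  by rewrite /cutoff /quartic /capillary_fun; ring.
rewrite -E.
pose A := [set y | closed_half_space R n y /\ 0 <= phi y].
have Acl : closed A by apply: closed_superlevel; exact: cont_to_boundary_level.
have Ac : compact A by exact: compact_level.
have cP : {within A, continuous (fun z => cutoff u s C d m 0 1 z * capillary_fun u 0 z)}.
  apply: (@continuous_subspaceW _ _ _ (closed_half_space R n)); first by move=> z [].
  apply/cont_to_boundary_within; apply: cont_to_boundaryM.
    exact: cont_to_boundary_cutoff.
  exact: cont_to_boundary_capillary_fun.
have [|z zA zmax] := @EVT_max_rV R n.+1 _ A _ Ac cP; first by exists y.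
apply: le_trans (zmax y _) _; first by rewrite inE.
move: zA; rewrite inE => -[zC phiz]; rewrite E.
have W0 := area_element_gt0 u z.
have dz0 := depth_ge0 zC; have dz16 := depth_le zC phiz; have phi1 := level_le1 zC.
move: phiz; rewrite le_eqVlt => /orP[/eqP<-|phiz]; first by rewrite expr0n mul0r mulr0 ler0n.
move: dz0; rewrite le_eqVlt => /orP[/eqP<-|dz0]; first by rewrite expr0n !mulr0 ler0n.
have zU := half_space_depth dz0.
have p2 : phi z ^+ 2 <= 1 by rewrite expr_le1// ltW.
have t2 : depth z ^+ 2 <= 256.
  by rewrite (_ : 256 = 16 ^+ 2); [rewrite ler_sqr ?nnegrE// ltW|ring].
(* The bound is 2048 = 8 * 16^2, since phi <= 1 and t <= 16; the next case, W t <= 100 phi, gives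
   only 1600. *)
have [W8|W8] := leP (W z) 8.
  apply: le_trans (_ : 8 * (1 * 256) <= _); last lra.
  apply: ler_pM W8 _; [exact: ltW|by rewrite mulr_ge0 ?sqr_ge0|].
  by apply: ler_pM p2 t2; exact: sqr_ge0.
have [Wt|Wt] := leP (W z * depth z) (100 * phi z).
  have -> : W z * (phi z ^+ 2 * depth z ^+ 2) = W z * depth z * (phi z ^+ 2 * depth z) by ring.
  apply: le_trans (_ : (100 * phi z) * (phi z ^+ 2 * depth z) <= _).
    by rewrite ler_wpM2r// mulr_ge0 ?sqr_ge0// ltW.
  apply: le_trans (_ : (100 * 1) * (1 * 16) <= _); last lra.
  have pt0 : 0 <= phi z ^+ 2 * depth z by rewrite mulr_ge0 ?sqr_ge0// ltW.
  apply: ler_pM; [by rewrite mulr_ge0// ltW|exact: pt0| |].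
    by rewrite ler_pM2l.
  by apply: ler_pM p2 dz16; [exact: sqr_ge0|exact: ltW].
exfalso.
have eta0 : 0 < cutoff u s C d m 0 1 z.
  rewrite /cutoff /quartic !mul0r !add0r mul1r.
  by rewrite mulr_gt0 ?exprn_gt0.
have zmax' : \forall y \near z, cutoff u s C d m 0 1 y * capillary_fun u 0 y
      <= cutoff u s C d m 0 1 z * capillary_fun u 0 z.
  have H := near_level zU (@cont_to_boundary_level _ _ _ smooth_u s C d m) phiz.
  near=> x; apply: zmax; rewrite inE.
  have [xC x0] : closed_half_space R n x /\ 0 < phi x by near: x; exact: H.
  by split=> //; exact: ltW.
have := interior_max_level erefl erefl erefl erefl erefl zU eta0 zmax'.
have dz := dotv_level_le zC (ltW phiz).
have d01 : 0 <= d <= 1 / 160 by rewrite ltW.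
have /andP[A5 _] := level_covector_bounds m_gt0 s_sqr d01 dz (ltW W8).
have [H Hchi GE] := level_covector_chi u s m_gt0 dz.
have s1 : `|s| = 1 by apply/eqP; rewrite -sqrp_eq1// real_normK ?num_real// s_sqr.
have qW : `|s * grad u z ord0 ord0 / W z ^+ 2| * W z <= 1.
  rewrite normrM normrM s1 mul1r [`|(_ ^+ 2)^-1|]ger0_norm ?invr_ge0 ?sqr_ge0//.
  have -> : `|grad u z ord0 ord0| / W z ^+ 2 * W z = `|grad u z ord0 ord0| / W z.
    by field; rewrite gt_eqF.
  by rewrite ler_pdivrMr// mul1r; exact: normal_slope_bound.
have dtau : d ^+ 2 * frame_trace u z <= 1 / 200.
  by apply: le_trans d_sqr_le; rewrite ler_wpM2l ?sqr_ge0// frame_trace_le.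
have phi01 : 0 < phi z <= 1 by rewrite phiz.
have := interior_cutoff_positive phi01 dz0 (ltW Wt) qW A5 (chi_bounds u z) Hchi d01 dtau GE.
set X := (X in 0 < X) => X0.
(* With c = 0 the maximum condition makes W eta Lap(eta) nonpositive. *)
rewrite expr0n /= !mul0r leNgt => /negP; apply.
rewrite mulr_gt0//; first by rewrite mulr_gt0// /capillary_fun mul0r addr0.
apply: lt_le_trans X0 _; rewrite le_eqVlt; apply/orP; left; apply/eqP.
by rewrite /X /quartic_hh /quartic_ht /quartic_h; ring.
Unshelve. all: by end_near. Qed.

End GradientBound.

(** If [df x] were positive, continuity up to the boundary and the mean value theorem would make f
    increase along a short inward segment. *)
Lemma normal_derive_le0 (R : realType) (n : nat) (f df : 'rV[R]_n.+1 -> R) x :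
  closed_half_space R n x -> cont_to_boundary f -> cont_to_boundary df ->
  (forall y, half_space R n y -> is_derive y (basis_vector ord0) f (df y)) ->
  (\forall t \near (0 : R)^'+, f (t *: basis_vector ord0 + x) <= f x) -> df x <= 0.
Proof.
move=> xC cf cdf fd fmax; rewrite leNgt; apply/negP => df0.
pose line (t : R) := t *: basis_vector ord0 + x.
have lineC t : 0 <= t -> closed_half_space R n (line t).
  by move=> t0; exact: closed_half_space_normal.
have line0 : line 0 = x by rewrite /line scale0r add0r.
have cdf0 : df (line t) @[t --> 0^'+] --> df x.
  rewrite -[X in _ --> df X]line0; apply: cont_to_boundary_normal => //.
    exact: cvg_at_right_filter.
  by near=> t; apply: ltW; near: t; exact: nbhs_right_gt.
have [r /= r0 Hr] : \forall t \near (0 : R)^'+, 0 < df (line t) /\ f (line t) <= f x.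
  by apply: filterI; [move/cvgr_gt: cdf0 => /(_ 0 df0)|exact: fmax].
have {}Hr t : 0 < t < r -> 0 < df (line t) /\ f (line t) <= f x.
  by move=> /andP[t0 tr]; apply: Hr; rewrite //= sub0r normrN gtr0_norm.
have h0 : 0 < r / 2 by rewrite divr_gt0.
have hr : r / 2 < r by rewrite ltr_pdivrMr// ltr_pMr// ltr1n.
have lineU t : 0 < t -> half_space R n (line t).
  move=> t0; rewrite /half_space /= !mxE eqxx mulr1.
  by rewrite ltr_pwDl.
have gd t : t \in `]0, r / 2[ -> is_derive t 1 (fun t => f (line t)) (df (line t)).
  rewrite in_itv/= => /andP[t0 _].
  exact: (is_derive_lineP f x (basis_vector ord0) t (df (line t))).1 (fd _ (lineU _ t0)).
have gc : {within `[0, r / 2], continuous (fun t => f (line t))}.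
  apply/subspace_continuousP => t; rewrite /= in_itv/= => /andP[t0 _].
  apply: cont_to_boundary_normal => //; first exact: cvg_within.
  by rewrite near_withinE; near=> z; rewrite /= in_itv/= => /andP[].
have [t + E] := MVT h0 gd gc; rewrite in_itv/= => /andP[t0 th].
have : 0 < f (line (r / 2)) - f (line 0).
  rewrite E subr0 mulr_gt0//; apply: (Hr t _).1.
  by rewrite t0 (lt_trans th hr).
rewrite line0 subr_gt0 ltNge (Hr (r / 2) _).2//.
by rewrite h0.
Unshelve. all: by end_near. Qed.

(** * The capillary condition at a boundary maximum *)

Section BoundaryMaximum.
Context {R : realType} {n : nat} (u : 'rV[R]_n.+1 -> R).
Context (smooth_u : smooth_up_to_boundary u) (c : R).
Context (capillary_u : forall x, half_space_boundary R n x ->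
  partial ord0 u x = - c * area_element u x).
Implicit Types (x y b : 'rV[R]_n.+1) (i : 'I_n.+1).
Local Notation W := (area_element u).
Local Notation D s := (iter_partial s u).
Local Notation e0 := (basis_vector ord0).
Local Notation gm x := (graph_metric (grad u x) (W x)).
Local Notation q x := ((W x)^-1 *: grad u x + c *: e0).

Lemma boundary_line i (t : R) x : half_space_boundary R n x -> i != ord0 ->
  half_space_boundary R n (t *: basis_vector i + x).
Proof.
move=> x0 i0; rewrite /half_space_boundary /= !mxE eqxx/= eq_sym (negbTE i0) mulr0 add0r.
exact: x0.
Qed.

Lemma boundary_closed x : half_space_boundary R n x -> closed_half_space R n x.
Proof. by rewrite /half_space_boundary /closed_half_space /= => ->. Qed.

(** The capillary condition u_1 = - c W, differentiated along the boundary. *)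
Lemma capillary_tangential i x : half_space_boundary R n x -> i != ord0 ->
  ((e0 + (c / W x) *: grad u x) *m hess u x) ord0 i = 0.
Proof.
move=> xB i0; have xC := boundary_closed xB.
have HA := smooth_derivable_tangent smooth_u xC i0.
have /is_derive_lineP0 H1 := HA [:: ord0].
have /is_derive_lineP0 := is_derive_scalef (- c) (is_derive_area HA).
rewrite (_ : (fun t => - c * W (t *: basis_vector i + x))
  = fun t => D [:: ord0] (t *: basis_vector i + x)); last first.
  by apply/funext => t; rewrite -capillary_u//; exact: boundary_line.
move=> H2; have := etrans (esym (@derive_val _ _ _ _ _ _ _ H1)) (@derive_val _ _ _ _ _ _ _ H2).
rewrite (dir_deriv0_hess smooth_u _ xC) (darea_hess smooth_u _ xC) !dotv_delta => E.
have W0 : W x != 0 by rewrite gt_eqF// area_element_gt0.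
rewrite mulmxDl -scalemxAl [LHS]mxE E [X in _ + X]mxE; field.
exact: W0.
Qed.

(* The conormal derivative of [capillary_fun] vanishes: pairing with the
   conormal moves the Hessian onto a vector which the tangential derivative of
   the capillary condition makes normal to the boundary, a direction in which
   [q] has no component. *)
Lemma conormal_capillary x : half_space_boundary R n x -> gm x (q x *m hess u x) e0 = 0.
Proof.
move=> xB; have xC := boundary_closed xB.
have W0 : W x != 0 by rewrite gt_eqF// area_element_gt0.
have p0 : grad u x ord0 ord0 = - c * W x by rewrite gradE; exact: capillary_u.
(* Raising the index of e_1 gives e_1 - (u_1 / W^2) grad u, and u_1 = - c W. *)
have -> : gm x (q x *m hess u x) e0 = dotv (q x *m hess u x) (e0 + (c / W x) *: grad u x).
  rewrite /graph_metric dotvDr dotvZr (dotvC e0) !dotv_delta p0; field; exact: W0.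
rewrite dotv_mul (trmx_hess smooth_u xC).
rewrite /dotv (bigD1 ord0)//= big1 ?addr0 => [|i i0]; last first.
  by rewrite capillary_tangential// mulr0.
have -> : (q x) ord0 ord0 = 0.
  rewrite [LHS]mxE [X in X + _]mxE [X in _ + X]mxE p0 [e0 _ _]mxE eqxx/= mulr1n; field.
  exact: W0.
by rewrite mul0r.
Qed.

Context (s C d m : R) (m_gt0 : 0 < m) (a K : R).
Local Notation eta := (cutoff u s C d m a K).
Local Notation vf := (capillary_fun u c).

(** At such a maximum the differential of eta v is a nonpositive multiple of e_1, so its conormal
    component is nonpositive; the contribution of v to that component is zero by
    [conormal_capillary]. *)
Lemma boundary_max_cutoff x : half_space_boundary R n x ->
  0 < eta x -> 0 < vf x ->
  (forall i, i != ord0 -> \forall t \near (0 : R),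
     eta (t *: basis_vector i + x) * vf (t *: basis_vector i + x) <= eta x * vf x) ->
  (\forall t \near (0 : R)^'+,
     eta (t *: e0 + x) * vf (t *: e0 + x) <= eta x * vf x) ->
  gm x (cutoff_covector u s C d m a K x) e0 <= 0.
Proof.
move=> xB eta0 v0 maxT maxN; have xC := boundary_closed xB.
pose P y := eta y * vf y.
pose P1 b y := dcutoff u s C d m a K b y * vf y + eta y * dcapillary_fun u c b y.
have dP b y : derivable_along u b y -> is_derive y b P (P1 b y).
  move=> yA; apply: is_derive_mulf; first exact: is_derive_cutoff.
  exact: is_derive_capillary_fun.
pose zeta := vf x *: cutoff_covector u s C d m a K x + eta x *: (q x *m hess u x).
have P1E b : P1 b x = dotv zeta b.
  rewrite /P1 dcutoff_covector// (dcapillary_fun_hess smooth_u _ _ xC).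
  by rewrite dotvDl !dotvZl mulrC.
have zetaT i : i != ord0 -> zeta ord0 i = 0.
  move=> i0; rewrite -dotv_delta -P1E.
  have HA t : derivable_along u (basis_vector i) (t *: basis_vector i + x).
    by apply: smooth_derivable_tangent => //; exact/boundary_closed/boundary_line.
  have := HA 0; rewrite scale0r add0r => /dP/is_derive_lineP0 HP.
  apply: (derive_local_max HP); last by rewrite scale0r add0r; exact: maxT.
  by near=> t; have /dP/is_derive_lineP[] := HA t.
have zetaN : zeta ord0 ord0 <= 0.
  rewrite -dotv_delta -P1E; apply: (@normal_derive_le0 _ _ P (P1 e0)) => //.
  - by apply: cont_to_boundaryM; [exact: cont_to_boundary_cutoff|exact: cont_to_boundary_capillary_fun].
  - apply: cont_to_boundaryD; apply: cont_to_boundaryM.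
    + exact: cont_to_boundary_dcutoff.
    + exact: cont_to_boundary_capillary_fun.
    + exact: cont_to_boundary_cutoff.
    + exact: cont_to_boundary_dcapillary_fun.
  - by move=> y yU; apply: dP; exact: smooth_derivable_along.
have zetaE : zeta = zeta ord0 ord0 *: e0.
  apply/rowP => i; rewrite [RHS]mxE [X in _ * X]mxE eqxx /=.
  by have [->|i0] := eqVneq i ord0; [rewrite mulr1|rewrite mulr0 zetaT].
have : gm x zeta e0 <= 0.
  rewrite zetaE graph_metricZl mulr_le0_ge0//.
  by case/andP: (chi_bounds u x).
rewrite /zeta graph_metricDl !graph_metricZl conormal_capillary// mulr0 addr0.
by rewrite pmulr_rle0.
Unshelve. all: by end_near. Qed.

End BoundaryMaximum.

(** * The estimate in the wedge *)

Section WedgeEstimate.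
Context {R : realType} {n : nat} (u : 'rV[R]_n.+1 -> R).
Context (smooth_u : smooth_up_to_boundary u).
Context (minimal_u : forall x, half_space R n x ->
  divergence (fun y => (area_element u y)^-1 *: grad u y) x = 0).
Context (c : R) (capillary_u : forall x, half_space_boundary R n x ->
  partial ord0 u x = - c * area_element u x).
Context (s C d m K : R) (m_gt0 : 0 < m) (s_sqr : s ^+ 2 = 1).
Context (d_gt0 : 0 < d) (d_le : d <= 1 / 160) (d_sqr_le : d ^+ 2 * n.+1%:R <= 1 / 200).
Context (u_le : forall y, closed_half_space R n y -> s * (u y - C) <= 0).
Context (c_lt1 : `|c| < 1) (d_le_sin : d <= (1 - c ^+ 2) / 64).
Context (K_ge : 31 <= K * (1 - `|c|)).
Implicit Types (x y b : 'rV[R]_n.+1).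
Local Notation W := (area_element u).
Local Notation phi := (level u s C d m).
Local Notation depth := (@normal_depth R n m).
Local Notation e0 := (basis_vector ord0).
Local Notation gm x := (graph_metric (grad u x) (W x)).
Local Notation vf := (capillary_fun u c).
Local Notation eta := (cutoff u s C d m 1 K).

Lemma capillary_fun_ge x : (1 - `|c|) * W x <= vf x.
Proof.
rewrite /capillary_fun mulrBl mul1r lerD2l lerNl -gradE.
rewrite (le_trans (ler_norm _))// normrN normrM ler_wpM2l//.
exact: normal_slope_bound.
Qed.

Lemma capillary_fun_le x : vf x <= 2 * W x.
Proof.
rewrite /capillary_fun -gradE mulr_natl mulr2n lerD2l (le_trans (ler_norm _))// normrM.
rewrite -[leRHS]mul1r; apply: ler_pM => //; first exact: ltW.
exact: normal_slope_bound.
Qed.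

Lemma near_closed_line (f : 'rV[R]_n.+1 -> R) x b : cont_to_boundary f ->
  closed_half_space R n x -> 0 < f x ->
  \forall t \near (0 : R), closed_half_space R n (t *: b + x) -> 0 < f (t *: b + x).
Proof.
move=> cf xC fx0; have /cvgr_gt/(_ 0 fx0) := cf x xC.
rewrite near_withinE => /(@near_line _ _ _ x b)[r r0 Hr].
near=> t; apply: Hr; near: t.
exact: (@nbhs0_lt R R^o _ r0).
Unshelve. all: by end_near. Qed.

(** For t = 0 the conormal derivative is phi^3 (4 G + chi) / m with chi = S = 1 - c^2. It equals
    phi^3 (2 q + 3 S / 4 - 8 d H) / m, where the bounds on W and d give |q| <= S / 8 and |d H| <= S
    / 64. *)
Lemma wedge_boundary_cutoff x : half_space_boundary R n x -> 0 < phi x ->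
  8 / (1 - c ^+ 2) <= W x -> 0 < gm x (cutoff_covector u s C d m 1 K x) e0.
Proof.
move=> xB phix Wx; have xC := boundary_closed xB; have W0 := area_element_gt0 u x.
have t0 : depth x = 0 by rewrite /normal_depth; move: xB => ->; rewrite mul0r.
set S := 1 - c ^+ 2 in Wx *; have dS : d <= S / 64 := d_le_sin.
have c2 : c ^+ 2 < 1 by rewrite -real_normK ?num_real// expr_lt1.
have S0 : 0 < S by rewrite subr_gt0.
have p0 : grad u x ord0 ord0 = - c * W x by rewrite gradE; exact: capillary_u.
have chiE : gm x e0 e0 = S.
  rewrite /graph_metric (dotvC e0 (grad u x)) !dotv_delta p0 mxE !eqxx/= mulr1n /S.
  by field; rewrite gt_eqF.
have dz := dotv_level_le m_gt0 u_le xC (ltW phix).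
have [H Hchi GE] := level_covector_chi u s m_gt0 dz.
rewrite /cutoff_covector t0 graph_metricZl mulr_gt0 ?invr_gt0//.
rewrite graph_metricDl !graph_metricZl GE chiE /quartic_h /quartic_t.
have s1 : `|s| = 1 by apply/eqP; rewrite -sqrp_eq1// real_normK ?num_real// s_sqr.
have S1 : S <= 1 by rewrite lerBlDr lerDl sqr_ge0.
have H1 : `|H| <= 1.
  rewrite -[leRHS](ger0_norm ler01) -ler_sqr ?nnegrE// !real_normK ?num_real// expr1n.
  by rewrite (le_trans Hchi)// chiE.
have q1 : `|s * grad u x ord0 ord0 / W x ^+ 2| <= S / 8.
  have -> : s * grad u x ord0 ord0 / W x ^+ 2 = - (s * c) * (W x)^-1.
    by rewrite p0; field; rewrite gt_eqF.
  rewrite normrM normrN normrM s1 mul1r [`|_^-1|]ger0_norm ?invr_ge0 ?(ltW W0)//.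
  apply: le_trans (_ : 1 * (W x)^-1 <= _).
    by rewrite ler_wpM2r ?invr_ge0 ?(ltW W0) ?(ltW c_lt1).
  by rewrite mul1r -(invf_div 8 S) lef_pV2 ?posrE// divr_gt0.
have dH : `|d * H| <= S / 64.
  rewrite normrM gtr0_norm//; apply: le_trans dS.
  by rewrite ler_piMr// ltW.
move: q1 dH; rewrite !ler_norml => /andP[q1 _] /andP[_ dH].
rewrite [ltRHS](_ : _ = phi x ^+ 3 * (2 * (s * grad u x ord0 ord0 / W x ^+ 2)
  + 3 / 4 * S - 8 * (d * H))); last first.
  by move: (s * _ / _) => q; field.
rewrite mulr_gt0 ?exprn_gt0//; lra.
Qed.

Lemma wedge_estimate y : closed_half_space R n y -> 0 <= phi y ->
  4 * K * depth y <= phi y ->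
  eta y * vf y <= 32 / (1 - c ^+ 2) + 64 * 2048 * K ^+ 2.
Proof.
move=> yC phiy wy.
set S := 1 - c ^+ 2.
have c2 : c ^+ 2 < 1 by rewrite -real_normK ?num_real// expr_lt1.
have S0 : 0 < S by rewrite subr_gt0.
have S1 : S <= 1 by rewrite lerBlDr lerDl sqr_ge0.
have kap0 : 0 < 1 - `|c| by rewrite subr_gt0.
have kap1 : 1 - `|c| <= 1 by rewrite lerBlDr lerDl.
have K0 : 0 < K by rewrite -(pmulr_lgt0 _ kap0); apply: lt_le_trans K_ge.
have K31 : 31 <= K by apply: le_trans K_ge _; rewrite ler_piMr// ltW.
pose f z := phi z + - (4 * K) * depth z.
have cf : cont_to_boundary f.
  apply: cont_to_boundaryD; first exact: cont_to_boundary_level.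
  by apply: cont_to_boundaryM; [exact: cont_to_boundary_cst|exact: cont_to_boundary_depth].
pose wedge := [set z | closed_half_space R n z /\ 0 <= f z].
have Acl : closed wedge by exact: closed_superlevel.
have Asub : wedge `<=` [set z | closed_half_space R n z /\ 0 <= phi z].
  move=> z [zC fz]; split=> //; move: fz; rewrite /f mulNr subr_ge0; apply: le_trans.
  by rewrite mulr_ge0 ?depth_ge0// mulr_ge0// ltW.
have Ac : compact wedge by exact: (compact_level m_gt0 d_gt0 u_le Acl Asub).
have cP : {within wedge, continuous (fun z => eta z * vf z)}.
  apply: (@continuous_subspaceW _ _ _ (closed_half_space R n)); first by move=> z [].
  apply/cont_to_boundary_within; apply: cont_to_boundaryM.
    exact: cont_to_boundary_cutoff.
  exact: cont_to_boundary_capillary_fun.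
have [|z zA zmax] := @EVT_max_rV R n.+1 _ wedge _ Ac cP.
  by exists y; split=> //; rewrite /f mulNr subr_ge0.
apply: le_trans (zmax y _) _; first by rewrite inE; split=> //; rewrite /f mulNr subr_ge0.
move: zA; rewrite inE => -[zC fz]; have [_ phiz] := Asub z (conj zC fz).
have wz : 4 * K * depth z <= phi z by move: fz; rewrite /f mulNr subr_ge0.
have W0 := area_element_gt0 u z; have phi1 := level_le1 d m_gt0 u_le zC.
have t0 := depth_ge0 m_gt0 zC.
have vz0 : 0 < vf z by apply: lt_le_trans (capillary_fun_ge z); rewrite mulr_gt0.
have tz1 : depth z <= phi z / 124.
  have : 124 * depth z <= 4 * K * depth z by rewrite ler_wpM2r//; lra.
  lra.
have eta_le : eta z <= 2 * phi z ^+ 4.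
  have h1 : phi z * depth z <= phi z ^+ 2 / 124.
    by have := ler_wpM2l phiz tz1; rewrite expr2; lra.
  have h2 : K * depth z ^+ 2 <= phi z ^+ 2 / 124.
    by have := ler_wpM2r t0 wz; have := h1; have := mulr_ge0 phiz t0; rewrite expr2; lra.
  have p2 : 0 <= phi z ^+ 2 by exact: sqr_ge0.
  rewrite /cutoff /quartic (_ : 2 * phi z ^+ 4 = phi z ^+ 2 * (2 * phi z ^+ 2)); last by ring.
  by rewrite ler_wpM2l//; lra.
have eta_ge : phi z ^+ 4 <= eta z.
  rewrite /cutoff /quartic (_ : phi z ^+ 4 = phi z ^+ 2 * phi z ^+ 2); last by ring.
  rewrite ler_wpM2l ?sqr_ge0// !mul1r -addrA lerDl.
  by apply: addr_ge0; apply: mulr_ge0; rewrite ?sqr_ge0// ltW.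
have p4 : 0 <= phi z ^+ 4 by rewrite exprn_ge0.
have eta0 : 0 <= eta z by exact: le_trans eta_ge.
(* In the wedge eta lies between phi^4 and 2 phi^4, and v <= 2 W. *)
have Pz : eta z * vf z <= 4 * (W z * phi z ^+ 4).
  apply: le_trans (ler_pM eta0 (ltW vz0) eta_le (capillary_fun_le z)) _.
  by rewrite le_eqVlt; apply/orP; left; apply/eqP; ring.
have KK0 : 0 <= 64 * 2048 * K ^+ 2 by exact: mulr_ge0 (mulr_ge0 (ler0n _ _) (ler0n _ _)) (sqr_ge0 _).
have SS0 : 0 <= 32 / S by rewrite divr_ge0// ltW.
(* Here 4 W phi^4 <= 4 * 8 / S, the first term of the bound. *)
have [W8|W8] := leP (W z) (8 / S).
  have : W z * phi z ^+ 4 <= 8 / S * 1.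
    by apply: ler_pM => //; [exact: ltW|exact: exprn_ile1].
  lra.
(* On the face phi = 4 K t one has phi^4 = 16 K^2 phi^2 t^2, so the interior estimate gives 4 * 16
   K^2 * 2048. The vertex phi = t = 0 belongs to this case. *)
have [wz0|wz0] := leP (phi z) (4 * K * depth z).
  have E : phi z = 4 * K * depth z by apply/eqP; rewrite eq_le wz0 wz.
  have := interior_estimate smooth_u minimal_u m_gt0 s_sqr d_gt0 d_le d_sqr_le u_le zC phiz.
  rewrite (_ : W z * phi z ^+ 4 = 16 * K ^+ 2 * (W z * (phi z ^+ 2 * depth z ^+ 2))) in Pz.
    move=> h; have K2 : 0 <= 16 * K ^+ 2 by rewrite mulr_ge0 ?sqr_ge0.
    have := ler_wpM2l K2 h; lra.
  by rewrite E; ring.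
have phiz0 : 0 < phi z.
  by apply: le_lt_trans wz0; rewrite mulr_ge0// mulr_ge0// ltW.
have etaz0 : 0 < eta z by apply: lt_le_trans eta_ge; rewrite exprn_gt0.
have fz0 : 0 < f z by rewrite /f mulNr subr_gt0.
have W8' : 8 <= W z.
  by apply: le_trans (ltW W8); rewrite ler_pdivlMr// ler_piMr.
exfalso; move: t0; rewrite le_eqVlt => /orP[/eqP t0|t0].
  have zB : half_space_boundary R n z.
    by move: t0 => /esym/eqP; rewrite /normal_depth mulf_eq0 invr_eq0 (gt_eqF m_gt0) orbF => /eqP.
  have := wedge_boundary_cutoff zB phiz0 (ltW W8); rewrite ltNge => /negP; apply.
  apply: (boundary_max_cutoff smooth_u capillary_u m_gt0 zB etaz0 vz0).
    move=> i i0; have H := @near_closed_line f z (basis_vector i) cf zC fz0.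
    near=> t; apply: zmax; rewrite inE.
    have tC : closed_half_space R n (t *: basis_vector i + z).
      by apply: boundary_closed; exact: boundary_line.
    by split=> //; apply: ltW; apply: (near H t).
  have H := @near_closed_line f z e0 cf zC fz0.
  have {}H : \forall t \near (0 : R)^'+,
      closed_half_space R n (t *: e0 + z) -> 0 < f (t *: e0 + z).
    exact: cvg_within H.
  near=> t; apply: zmax; rewrite inE.
  have tC : closed_half_space R n (t *: e0 + z).
    by apply: closed_half_space_normal => //; apply: ltW; near: t; exact: nbhs_right_gt.
  by split=> //; apply: ltW; apply: (near H t).
have zU := half_space_depth m_gt0 t0.
have zmax' : \forall x \near z, eta x * vf x <= eta z * vf z.
  have H := near_level zU cf fz0.
  near=> x; apply: zmax; rewrite inE.
  have [xC x0] : closed_half_space R n x /\ 0 < f x by near: x; exact: H.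
  by split=> //; exact: ltW.
have := interior_max_level smooth_u minimal_u m_gt0 erefl erefl erefl erefl erefl zU etaz0 zmax'.
have dz := dotv_level_le m_gt0 u_le zC phiz.
have d01 : 0 <= d <= 1 / 160 by rewrite ltW.
have A1 := level_covector_bounds m_gt0 s_sqr d01 dz W8'.
have dtau : d ^+ 2 * frame_trace u z <= 1 / 200.
  by apply: le_trans d_sqr_le; rewrite ler_wpM2l ?sqr_ge0// frame_trace_le.
have psd (a b : R) : 0 <= a ^+ 2 * gm z (level_covector u s d m z) (level_covector u s d m z)
    + 2 * a * b * gm z (level_covector u s d m z) e0 + b ^+ 2 * gm z e0 e0.
  have := graph_metricvv_ge0 W0 (area_element_dotv u z) (a *: level_covector u s d m z + b *: e0).
  move: (level_covector u s d m z) e0 => al e.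
  rewrite !(graph_metricDl, graph_metricDr, graph_metricZl, graph_metricZr).
  rewrite (graph_metricC _ _ e al) => h; apply: le_trans h _.
  by rewrite le_eqVlt; apply/orP; left; apply/eqP; ring.
have chi01 := chi_bounds u z; have := psd 1 1.
move: (gm z (level_covector u s d m z) (level_covector u s d m z)) A1 psd => A A1 psd.
move: (gm z (level_covector u s d m z) e0) psd => G psd.
move: (gm z e0 e0) chi01 psd => chi chi01 psd G1.
have G1' : - (A + chi) <= 2 * G by lra.
have FE : quartic_h 1 K (phi z) (depth z)
   = 4 * phi z ^+ 3 + 3 * phi z ^+ 2 * depth z + 2 * K * phi z * depth z ^+ 2.
  by rewrite /quartic_h mul1r.
have YE : quartic_t 1 K (phi z) (depth z) = phi z ^+ 3 + 2 * K * phi z ^+ 2 * depth z.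
  by rewrite /quartic_t mul1r.
have phi01 : 0 < phi z <= 1 by rewrite phiz0.
have kap01 : 0 < 1 - `|c| <= 1 by rewrite kap0.
have := wedge_cutoff_positive FE YE phi01 (ltW t0) wz kap01 K_ge A1 chi01 dtau G1' psd.
have q0 := psd (quartic_h 1 K (phi z) (depth z)) (quartic_t 1 K (phi z) (depth z)).
move: (quartic_h 1 K (phi z) (depth z)) (quartic_t 1 K (phi z) (depth z)) q0 => F Y.
rewrite /quartic_hh /quartic_ht !mul1r mulr1 => q0.
have -> : phi z ^+ 2 * (phi z ^+ 2 + phi z * depth z + K * depth z ^+ 2) = eta z.
  by rewrite /cutoff /quartic !mul1r.
have -> : F * (2 * d ^+ 2 * frame_trace u z) = 2 * F * (d ^+ 2 * frame_trace u z) by ring.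
move: (_ * A + _ + _ - _) => Q; move: (_ + _ * chi) q0 => B q0 BQ QB.
have chi0 : 0 <= chi by case/andP: chi01.
have Q0 : 0 < eta z * Q.
  have : 0 < (1 - `|c|) * eta z * Q by apply: le_lt_trans BQ; rewrite mulr_ge0.
  by rewrite -mulrA pmulr_rgt0.
(* With v >= (1 - |c|) W and c^2 < 1 the maximum inequality reverses the strict inequality of
   [wedge_cutoff_positive]. *)
have h1 : (1 - `|c|) * W z * (eta z * Q) <= vf z * (eta z * Q).
  by rewrite ler_wpM2r ?capillary_fun_ge// ltW.
have h2 : c ^+ 2 * W z * B * chi <= W z * (B * chi).
  rewrite (_ : c ^+ 2 * W z * B * chi = c ^+ 2 * (W z * (B * chi))); last by ring.
  by rewrite ler_piMl// ?(ltW c2)// mulr_ge0 ?mulr_ge0// ltW.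
have h3 : W z * (B * chi) < W z * ((1 - `|c|) * eta z * Q) by rewrite ltr_pM2l.
have : W z * ((1 - `|c|) * eta z * Q) < W z * ((1 - `|c|) * eta z * Q).
  apply: le_lt_trans h3; apply: le_trans h2; apply: le_trans QB.
  by rewrite -(mulrA (vf z)); apply: le_trans h1; rewrite le_eqVlt; apply/orP; left; apply/eqP; ring.
by rewrite ltxx.
Unshelve. all: by end_near. Qed.

End WedgeEstimate.

(** * Choice of the parameters and conclusion *)

Lemma smooth_le_closed (R : realType) (n : nat) (u : 'rV[R]_n.+1 -> R) (s C : R) :
  smooth_up_to_boundary u -> (forall y, half_space R n y -> s * (u y - C) <= 0) ->
  forall y, closed_half_space R n y -> s * (u y - C) <= 0.
Proof.
move=> us uC y yC.
have cu : cont_to_boundary (fun z => s * (u z + - C)).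
  apply: cont_to_boundaryM; first exact: cont_to_boundary_cst.
  apply: cont_to_boundaryD; last exact: cont_to_boundary_cst.
  exact: (smooth_cvg us (s := [::])).
have : s * (u (t *: basis_vector ord0 + y) + - C) @[t --> 0^'+] -->
    s * (u (0 *: basis_vector ord0 + y) + - C).
  apply: (cont_to_boundary_normal (t0 := 0)) cu yC _ _ _ => //.
    exact: cvg_at_right_filter.
  by near=> t; apply: ltW; near: t; exact: nbhs_right_gt.
rewrite scale0r add0r => H; apply: (cvgr_to_le H).
near=> t; apply: uC; rewrite /half_space /= !mxE eqxx mulr1 ltr_pwDl//.
Unshelve. all: by end_near. Qed.

Lemma enorm_grad_le (R : realType) (n : nat) (u : 'rV[R]_n.+1 -> R) x :
  enorm (grad u x) <= area_element u x.
Proof. by rewrite /area_element -[leLHS]ger0_norm ?sqrtr_ge0// -sqrtr_sqr ler_wsqrtr// lerDr. Qed.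

Theorem theorem1p6 (R : realType) (n : nat) (hn : (2 <= n.+1)%N)
    (theta : R) (htheta : 0 < theta < pi) :
  exists Lambda : R, 0 < Lambda /\
    forall u : 'rV[R]_n.+1 -> R,
      smooth_up_to_boundary u ->
      capillary_minimal_graph theta u ->
      has_ubound (u @` half_space R n) \/ has_lbound (u @` half_space R n) ->
      (ereal_sup [set (enorm (grad u x))%:E | x in closed_half_space R n]
         <= Lambda%:E)%E.
Proof.
set c := cos theta; set S := 1 - c ^+ 2; set kappa := 1 - `|c|.
have S0 : 0 < S.
  have -> : S = sin theta ^+ 2 by rewrite /S -(cos2Dsin2 theta) /c addrAC subrr add0r.
  by rewrite exprn_gt0// sin_gt0_pi.
have c1 : `|c| < 1.
  by rewrite -(@expr_lt1 _ 2)// real_normK ?num_real// -subr_gt0.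
have S1 : S <= 1 by rewrite lerBlDr lerDl sqr_ge0.
have kap0 : 0 < kappa by rewrite subr_gt0.
have N1 : 1 <= n.+1%:R :> R by rewrite ler1n.
have N0 : 0 < n.+1%:R :> R by rewrite ltr0n.
(* One d meets all three smallness conditions: d <= 1 / 160 for the gradient of phi, d <= S / 64 for
   the boundary, and d^2 times the dimension at most 1 / 200 for Lap(phi). *)
pose K := 31 / kappa; pose d := S / (160 * n.+1%:R).
have KE : 31 <= K * kappa by rewrite /K divfK// gt_eqF.
have K0 : 0 < K by rewrite divr_gt0.
have dN : d * n.+1%:R = S / 160 by rewrite /d; field; rewrite gt_eqF.
have d0 : 0 < d by rewrite divr_gt0// mulr_gt0.
have dS : d <= S / 160 by rewrite -dN ler_peMr// ltW.
have d_le : d <= 1 / 160 by lra.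
have d_sin : d <= S / 64 by lra.
have d_sqr : d ^+ 2 * n.+1%:R <= 1 / 200.
  have S160 : 0 <= S / 160 by lra.
  rewrite expr2 -mulrA dN; have := ler_wpM2r S160 d_le; lra.
pose C2 := 32 / S + 64 * 2048 * K ^+ 2.
have C20 : 0 < C2.
  apply: ltr_wpDr; last by rewrite divr_gt0.
  exact: mulr_ge0 (mulr_ge0 (ler0n _ _) (ler0n _ _)) (sqr_ge0 _).
(* At the given point phi >= 1 / 4, so eta >= phi^4 >= 1 / 256, while v >= [kappa] W. *)
exists (256 * C2 / kappa); split.
  exact: divr_gt0 (mulr_gt0 (ltr0Sn _ 255) C20) kap0.
move=> u us [min cap] bnd; apply: ub_ereal_sup => _ [x xC <-]; rewrite lee_fin.
have [s [C [s2 uC]]] : exists s C : R, s ^+ 2 = 1 /\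
    forall y, closed_half_space R n y -> s * (u y - C) <= 0.
  case: bnd => -[C HC].
    exists 1, C; split; first by rewrite expr1n.
    apply: smooth_le_closed => // y yU; rewrite mul1r subr_le0.
    by apply: HC; exists y.
  exists (-1), C; split; first by rewrite sqrrN expr1n.
  apply: smooth_le_closed => // y yU; rewrite mulN1r oppr_le0 subr_ge0.
  by apply: HC; exists y.
apply: le_trans (enorm_grad_le u x) _.
(* Each summand serves one bound at x: m >= 1, the u-term of phi at least - 1 / 2, 4 K t <= 1 / 4,
   and, through m <= m^2, the quadratic term at most 1 / 16. *)
pose m := 1 + `|u x - C| + 16 * K * x ord0 ord0 + 16 * d ^+ 2 * dotv x x.
have x0 : 0 <= x ord0 ord0 := xC.
have h1 : 0 <= `|u x - C| by [].
have h2 : 0 <= 16 * K * x ord0 ord0 by rewrite mulr_ge0// mulr_ge0// ltW.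
have h3 : 0 <= 16 * d ^+ 2 * dotv x x by rewrite mulr_ge0 ?dotvv_ge0// mulr_ge0 ?sqr_ge0.
have m1 : 1 <= m by rewrite /m; lra.
have m0 : 0 < m by lra.
have t_le : 4 * K * normal_depth m x <= 1 / 4.
  rewrite /normal_depth mulrA ler_pdivrMr//; rewrite /m; lra.
have t0 := depth_ge0 m0 xC.
have kap1 : kappa <= 1 by rewrite /kappa lerBlDr lerDl.
have K31 : 31 <= K by apply: le_trans KE _; rewrite ler_piMr// ltW.
have t_small : normal_depth m x <= 1 / 4.
  have := ler_wpM2r t0 K31; lra.
have phi_ge : 1 / 4 <= level u s C d m x.
  have s1 : `|s| = 1 by apply/eqP; rewrite -sqrp_eq1// real_normK ?num_real// s2.
  have a1 : - (1 / 2) <= s / (2 * m) * (u x - C).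
    suff : `|s / (2 * m) * (u x - C)| <= 1 / 2 by rewrite ler_norml => /andP[].
    have -> : `|s / (2 * m) * (u x - C)| = `|u x - C| / (2 * m).
      by rewrite !normrM s1 normfV (gtr0_norm (mulr_gt0 (ltr0Sn R 1) m0)) mul1r mulrC.
    rewrite ler_pdivrMr ?mulr_gt0// /m; lra.
  have a2 : (d / m) ^+ 2 * dotv x x <= 1 / 16.
    have -> : (d / m) ^+ 2 * dotv x x = d ^+ 2 * dotv x x / m ^+ 2.
      by field; rewrite gt_eqF.
    rewrite ler_pdivrMr ?exprn_gt0//.
    have : m <= m ^+ 2 by rewrite expr2 ler_peMr// ltW.
    rewrite {1}/m; lra.
  rewrite /level; lra.
have wx : 4 * K * normal_depth m x <= level u s C d m x by apply: le_trans t_le phi_ge.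
have phi0 : 0 <= level u s C d m x by lra.
have := wedge_estimate us min cap m0 s2 d0 d_le d_sqr uC c1 d_sin KE xC phi0 wx.
rewrite -/S -/C2 => est.
have v_ge := capillary_fun_ge u c x; rewrite -/kappa in v_ge.
have W0 := area_element_gt0 u x.
have eta_ge : 1 / 256 <= cutoff u s C d m 1 K x.
  rewrite /cutoff /quartic.
  have p2 : 1 / 16 <= level u s C d m x ^+ 2.
    have -> : 1 / 16 = (1 / 4) ^+ 2 :> R by field.
    by rewrite ler_sqr ?nnegrE//; lra.
  have -> : 1 / 256 = 1 / 16 * (1 / 16) :> R by field.
  have h16 : 0 <= 1 / 16 :> R by rewrite divr_ge0.
  apply: (ler_pM h16 h16 p2).
  have q1 : 0 <= level u s C d m x * normal_depth m x by rewrite mulr_ge0.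
  have q2 : 0 <= K * normal_depth m x ^+ 2 by rewrite mulr_ge0 ?sqr_ge0// ltW.
  lra.
have kW : 0 <= kappa * area_element u x by rewrite mulr_ge0// ltW.
have := le_trans (ler_pM (_ : 0 <= 1 / 256) kW eta_ge v_ge) est.
rewrite divr_ge0 ?ler0n// => /(_ isT) fin.
rewrite ler_pdivlMr//; lra.
Qed.
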